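(* Let $\Theta,f,A,B,S$ be as defined in the context, and suppose that the Gram matrices $\mathbf{F}$, $\mathbf{H}$ and $\mathbf{G}$ are invertible. Let $\theta^0=(p^0,M^0,c^0,v^0)\in\Theta$ be strictly feasible, i.e. $M^0+(M^0)^\top>0$ and $B_i(M^0,c^0)-A_i(M^0,c^0)-Z_i(v^0)-p_i^0I<0$ for all $i\in[N]$, and let $\theta^{k+1}=S(\theta^k)$, $k=0,1,2,\dots$. Then the sequence $\theta^k=(p^k,M^k,c^k,v^k)$, $k\in\mathbb{N}$, converges to a stationary point or to a continuum of stationary points of the problem $$\min_{\theta\in\Theta}\ f(\theta)\quad\text{s.t.}\quad B(\theta)-A(\theta)\le 0.$$
   Context: Let $n,N\in\mathbb{N}$, data $(x_i,\dot x_i,u_i)\in\mathbb{R}^n\times\mathbb{R}^n\times\mathbb{R}$, $i\in[N]=\{1,\dots,N\}$, and $\alpha,\beta,\gamma>0$. Let $\mathfrak{f},\mathfrak{g}:\mathbb{R}^n\times\mathbb{R}^n\to\mathbb{R}^{n\times n}$ and $\mathfrak{h}:\mathbb{R}^n\times\mathbb{R}^n\to\mathbb{R}$ be reproducing kernels (symmetric, $\mathfrak{f}(x,y)^\top=\mathfrak{f}(y,x)$, and positive semidefinite, i.e. all block Gram matrices are positive semidefinite; likewise for $\mathfrak{g},\mathfrak{h}$), with $\mathfrak{h}$ twice continuously differentiable. Put $\mathbf{F}_i=[\mathfrak{f}(x_i,x_1)\cdots\mathfrak{f}(x_i,x_N)]$, $\mathbf{G}_i=[\mathfrak{g}(x_i,x_1)\cdots\mathfrak{g}(x_i,x_N)]$,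 $\mathbf{H}_i=[\mathbf{H}_{i1}\cdots\mathbf{H}_{iN}]$, where $\mathbf{H}_{ij}\in\mathbb{R}^{n\times n}$ has $(k,l)$ entry equal to the mixed derivative of $\mathfrak{h}$ at $(x_i,x_j)$ with respect to the $k$-th component of the first variable and the $l$-th component of the second. The Gram matrices $\mathbf{F},\mathbf{G},\mathbf{H}\in\mathbb{R}^{nN\times nN}$ are obtained by stacking vertically the $\mathbf{F}_i,\mathbf{G}_i,\mathbf{H}_i$; they are symmetric positive semidefinite. $\mathbb{S}^q$ is the set of real symmetric $q\times q$ matrices, and $\le,\ge,<,>$ between symmetric matrices refer to (semi)definiteness. Let $\Theta=\mathbb{R}^N\times\mathbb{R}^{nN\times nN}\times\mathbb{R}^{nN}\times\mathbb{R}^{nN}$ with elements $\theta=(p,M,c,v)$ and the Euclidean (Frobenius) norm. Define $$f(p,M,c,v)=p^\top p+\alpha\,\mathrm{tr}(\mathbf{F}M\mathbf{F}M^\top)+\beta c^\top\mathbf{H}c+\gamma v^\top\mathbf{G}v,$$ and, as $(n+1)\times(n+1)$ matrices, $$X_i(M)=\begin{bmatrix}\mathbf{F}_iM^\top\mathbf{F}_i^\top&0\\0&0\end{bmatrix},\quad Y_i(c)=\begin{bmatrix}0&\mathbf{H}_ic\\0&0\end{bmatrix},\quad Z_i(v)=\begin{bmatrix}0&\dot x_i-u_i\mathbf{G}_iv\\(\dot x_i-u_i\mathbf{G}_iv)^\top&0\end{bmatrix},$$ $A_i(M,c)=X_i(M)^\top X_i(M)+Y_i(c)^\top Y_i(c)$,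 $B_i(M,c)=(X_i(M)-Y_i(c))^\top(X_i(M)-Y_i(c))$. Let $A,B:\Theta\to\mathbb{S}^{(n+1)N+nN}$ be block diagonal: $A(\theta)$ has diagonal blocks $A_i(M,c)+Z_i(v)+p_iI$, $i\in[N]$, and $M+M^\top$; $B(\theta)$ has diagonal blocks $B_i(M,c)$, $i\in[N]$, and $0\in\mathbb{R}^{nN\times nN}$. Let $\partial A(\theta),\partial B(\theta),\partial f(\theta)$ denote derivatives (gradient for $f$) at $\theta$. Define $$C(\theta)=\{\vartheta\in\Theta:\ B(\vartheta)-A(\theta)-\partial A(\theta)(\vartheta-\theta)\le 0\},\qquad S(\theta)=\operatorname*{arg\,min}_{\vartheta\in C(\theta)}f(\vartheta);$$ when $\mathbf{F},\mathbf{H},\mathbf{G}$ are invertible, the minimizer exists and is unique for every $\theta\in\Theta$, so $S:\Theta\to\Theta$ is well defined. (The iteration $\theta^{k+1}=S(\theta^k)$ is the paper's algorithm, run without stopping criterion.) Stationary point: $\theta\in\Theta$ is a stationary point of $\min f(\theta)$ s.t. $B(\theta)-A(\theta)\le0$ if $B(\theta)-A(\theta)\le 0$ and there exists $\Lambda\in\mathbb{S}^{(n+1)N+nN}$ with $\Lambda\ge 0$, $\partial f(\theta)+(\partial B(\theta)-\partial A(\theta))^*\Lambda=0$ and $\mathrm{tr}\big((B(\theta)-A(\theta))\Lambda\big)=0$, where $^*$ is the adjoint with respect to the trace inner product on symmetric matrices and the Euclidean inner product on $\Theta$. ''Converges to a stationary point or to a continuum of stationary points'' means: either the sequence converges to a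 stationary point, or the set of its accumulation points is a continuum (a compact connected set with more than one point) all of whose elements are stationary points. *)

(* Defs.v *)
From HB Require Import structures.
From mathcomp Require Import all_boot all_order all_algebra.
From mathcomp Require Import all_classical all_reals all_analysis.

Set Implicit Arguments.
Unset Strict Implicit.
Unset Printing Implicit Defensive.
Import Order.TTheory GRing.Theory Num.Theory.
Import numFieldNormedType.Exports.
Local Open Scope classical_set_scope.
Local Open Scope ring_scope.

Section Loewner.
Context {R : realType} {q : nat}.
Implicit Types A B : 'M[R]_q.

Definition psdmx A : Prop :=
  A^T = A /\ forall v : 'cV[R]_q, 0 <= (v^T *m A *m v) 0 0.

Definition pdmx A : Prop :=
  A^T = A /\ forall v : 'cV[R]_q, v != 0 -> 0 < (v^T *m A *m v) 0 0.

Definition loewner_le A B : Prop := psdmx (B - A).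

Definition loewner_lt A B : Prop := pdmx (B - A).

End Loewner.

Section Kernels.
Context {R : realType} {n : nat}.

Definition mxkernel (K : 'cV[R]_n -> 'cV[R]_n -> 'M[R]_n) : Prop :=
  (forall x y, (K x y)^T = K y x) /\
  forall (m : nat) (z : 'I_m -> 'cV[R]_n),
    psdmx (\mxblock_(i < m, j < m) K (z i) (z j)).

Definition scalar_kernel (h : 'cV[R]_n -> 'cV[R]_n -> R) : Prop :=
  (forall x y, h x y = h y x) /\
  forall (m : nat) (z : 'I_m -> 'cV[R]_n),
    psdmx (\matrix_(i < m, j < m) h (z i) (z j)).

Definition uncurried (h : 'cV[R]_n -> 'cV[R]_n -> R) :
  'cV[R]_n * 'cV[R]_n -> R := fun z => h z.1 z.2.

(* On a finite-dimensional space this is the usual class C^2. *)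
Definition twice_cont_diff {V : normedModType R} (phi : V -> R) : Prop :=
  [/\ forall z, differentiable phi z,
      forall v z, differentiable ('D_v phi) z &
      forall v w, continuous ('D_w ('D_v phi))].

Definition mixed_deriv (h : 'cV[R]_n -> 'cV[R]_n -> R) (x y : 'cV[R]_n) :
    'M[R]_n :=
  \matrix_(k < n, l < n)
    'D_(delta_mx k 0, 0) ('D_(0, delta_mx l 0) (uncurried h)) (x, y).

End Kernels.

Section Gram.
Context {R : realType} {n N : nat}.
Variables (K : 'cV[R]_n -> 'cV[R]_n -> 'M[R]_n) (x : 'I_N -> 'cV[R]_n).

Definition gram_row (i : 'I_N) : 'M[R]_(n, \sum_(j < N) n) :=
  \mxrow_(j < N) K (x i) (x j).

Definition gram : 'M[R]_(\sum_(j < N) n) := \mxcol_(i < N) gram_row i.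

End Gram.

(* The dimension nN is the \sum_(i < N) n of MathComp's block matrices.  The
   library puts the sup norm on this product; it induces the same topology and
   the same differentials as the Euclidean norm.  The Euclidean structure
   enters through ipTheta only. *)
Notation Theta R n N :=
  ('cV[R]_N * 'M[R]_(\sum_(i < N) n) *
   'cV[R]_(\sum_(i < N) n) * 'cV[R]_(\sum_(i < N) n))%type.

Section ParameterSpace.
Context {R : realType} {n N : nat}.
Implicit Types t s w eta : Theta R n N.

Definition th_p t : 'cV[R]_N := t.1.1.1.
Definition th_M t : 'M[R]_(\sum_(i < N) n) := t.1.1.2.
Definition th_c t : 'cV[R]_(\sum_(i < N) n) := t.1.2.
Definition th_v t : 'cV[R]_(\sum_(i < N) n) := t.2.

Definition ipTheta s t : R :=
  \tr ((th_p s)^T *m th_p t) + \tr ((th_M s)^T *m th_M t)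
  + \tr ((th_c s)^T *m th_c t) + \tr ((th_v s)^T *m th_v t).

(* The vector representing a linear form; see rieszP for existence. *)
Definition riesz (phi : Theta R n N -> R) : Theta R n N :=
  get [set w | forall eta, ipTheta w eta = phi eta].

Lemma rieszP (phi : {linear Theta R n N -> R}) eta :
  ipTheta (riesz phi) eta = phi eta.
Proof.
suff ex : [set w | forall e, ipTheta w e = phi e] !=set0 by exact: (getPex ex).
have trE (a b : nat) (X Y : 'M[R]_(a, b)) :
    \tr (X^T *m Y) = \sum_i \sum_j X i j * Y i j.
  rewrite exchange_big /=; apply: eq_bigr => j _; rewrite mxE.
  by apply: eq_bigr => i _; rewrite mxE.
have linE (a b : nat) (f : 'M[R]_(a, b) -> Theta R n N) (lf : linear f) Y :
    \tr ((\matrix_(i, j) phi (f (delta_mx i j)))^T *m Y) = phi (f Y).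
  pose fL : {linear 'M[R]_(a, b) -> Theta R n N} :=
    HB.pack f (GRing.isLinear.Build _ _ _ _ f lf).
  rewrite trE -[f]/(fL : _ -> _) {2}[Y]matrix_sum_delta !linear_sum.
  apply: eq_bigr => i _; rewrite !linear_sum; apply: eq_bigr => j _.
  by rewrite !linearZ /= mxE mulrC.
have pairD (s t : Theta R n N) : s + t =
    (s.1.1.1 + t.1.1.1, s.1.1.2 + t.1.1.2, s.1.2 + t.1.2, s.2 + t.2) by [].
have pairZ (a : R) (s : Theta R n N) : a *: s =
    (a *: s.1.1.1, a *: s.1.1.2, a *: s.1.2, a *: s.2) by [].
have lin1 : linear (fun p => (p, 0, 0, 0) : Theta R n N).
  by move=> a p q; rewrite pairD pairZ /= !scaler0 !addr0.
have lin2 : linear (fun M => (0, M, 0, 0) : Theta R n N).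
  by move=> a p q; rewrite pairD pairZ /= !scaler0 !addr0.
have lin3 : linear (fun c => (0, 0, c, 0) : Theta R n N).
  by move=> a p q; rewrite pairD pairZ /= !scaler0 !addr0.
have lin4 : linear (fun v => (0, 0, 0, v) : Theta R n N).
  by move=> a p q; rewrite pairD pairZ /= !scaler0 !addr0.
exists (\matrix_(i, j) phi (delta_mx i j, 0, 0, 0),
        \matrix_(i, j) phi (0, delta_mx i j, 0, 0),
        \matrix_(i, j) phi (0, 0, delta_mx i j, 0),
        \matrix_(i, j) phi (0, 0, 0, delta_mx i j)) => -[[[p M] c] v].
rewrite /ipTheta /th_p /th_M /th_c /th_v /=.
rewrite (linE _ _ _ lin1) (linE _ _ _ lin2) (linE _ _ _ lin3) (linE _ _ _ lin4).
rewrite -!linearD /=.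
by congr (phi _); rewrite !pairD /= !addr0 !add0r.
Qed.

Definition gradient (f : Theta R n N -> R) t : Theta R n N := riesz ('d f t).

Definition adjoint {q : nat} (L : Theta R n N -> 'M[R]_q) (Lam : 'M[R]_q) :
    Theta R n N :=
  riesz (fun eta => \tr (L eta *m Lam)).

End ParameterSpace.

Section Programs.
Context {R : realType} {n N q : nat}.
Variables (f : Theta R n N -> R) (A B : Theta R n N -> 'M[R]_q).
Implicit Types t s : Theta R n N.

Definition subfeasible t : set (Theta R n N) :=
  [set s | loewner_le (B s - A t - 'd A t (s - t)) 0].

Definition arg_min_set (C : set (Theta R n N)) : set (Theta R n N) :=
  [set s | C s /\ forall s', C s' -> f s <= f s'].

(* For the programs below, with invertible Gram matrices, the minimizer exists
   and is unique. *)
Definition mm_step t : Theta R n N := get (arg_min_set (subfeasible t)).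

Definition stationary_point t : Prop :=
  loewner_le (B t - A t) 0 /\
  exists Lam : 'M[R]_q,
    [/\ psdmx Lam,
        gradient f t + adjoint (fun eta => 'd B t eta - 'd A t eta) Lam = 0 &
        \tr ((B t - A t) *m Lam) = 0].

End Programs.

Section Convergence.
Context {T : topologicalType}.

Definition is_continuum (K : set T) : Prop :=
  [/\ compact K, connected K & exists a b, [/\ K a, K b & a <> b]].

(* cluster (theta @ \oo) is the set of accumulation points of theta. *)
Definition converges_to_point_or_continuum (theta : nat -> T) (P : T -> Prop) :
    Prop :=
  (exists2 t, theta @ \oo --> t & P t) \/
  (is_continuum (cluster (theta @ \oo)) /\
   forall t, cluster (theta @ \oo) t -> P t).

End Convergence.

Section Instance.
Context {R : realType} {n N : nat}.
Variables (f g : 'cV[R]_n -> 'cV[R]_n -> 'M[R]_n).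
Variables (h : 'cV[R]_n -> 'cV[R]_n -> R).
Variables (x xdot : 'I_N -> 'cV[R]_n) (u : 'I_N -> R).
Variables (alpha beta gamma : R).
Implicit Types (i : 'I_N) (M : 'M[R]_(\sum_(j < N) n)).
Implicit Types (c v : 'cV[R]_(\sum_(j < N) n)) (t : Theta R n N).

Let F := gram f x.
Let G := gram g x.
Let H := gram (mixed_deriv h) x.

Definition objective t : R :=
  ((th_p t)^T *m th_p t) 0 0
  + alpha * \tr (F *m th_M t *m F *m (th_M t)^T)
  + beta * ((th_c t)^T *m H *m th_c t) 0 0
  + gamma * ((th_v t)^T *m G *m th_v t) 0 0.

Definition Xblk i M : 'M[R]_(n + 1) :=
  block_mx (gram_row f x i *m M^T *m (gram_row f x i)^T) 0 0 0.

Definition Yblk i c : 'M[R]_(n + 1) :=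
  block_mx 0 (gram_row (mixed_deriv h) x i *m c) 0 0.

Definition Zblk i v : 'M[R]_(n + 1) :=
  let r := xdot i - u i *: (gram_row g x i *m v) in block_mx 0 r r^T 0.

Definition Ablk i M c : 'M[R]_(n + 1) :=
  (Xblk i M)^T *m Xblk i M + (Yblk i c)^T *m Yblk i c.

Definition Bblk i M c : 'M[R]_(n + 1) :=
  (Xblk i M - Yblk i c)^T *m (Xblk i M - Yblk i c).

Definition Amap t : 'M[R]_(\sum_(i < N) (n + 1) + \sum_(i < N) n) :=
  block_mx
    (\mxdiag_(i < N)
      (Ablk i (th_M t) (th_c t) + Zblk i (th_v t) + (th_p t i 0)%:M))
    0 0 (th_M t + (th_M t)^T).

Definition Bmap t : 'M[R]_(\sum_(i < N) (n + 1) + \sum_(i < N) n) :=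
  block_mx (\mxdiag_(i < N) Bblk i (th_M t) (th_c t)) 0 0 0.

Definition strictly_feasible t : Prop :=
  loewner_lt 0 (th_M t + (th_M t)^T) /\
  forall i, loewner_lt (Bblk i (th_M t) (th_c t) - Ablk i (th_M t) (th_c t)
                        - Zblk i (th_v t) - (th_p t i 0)%:M) 0.

End Instance.

(* Main.v *)
Require Import Defs.
From HB Require Import structures.
From mathcomp Require Import all_boot all_order all_algebra.
From mathcomp Require Import all_classical all_reals all_analysis.
From mathcomp Require Import ring lra.
Import Order.TTheory GRing.Theory Num.Theory.
Import numFieldNormedType.Exports.
Local Open Scope classical_set_scope.
Local Open Scope ring_scope.
Set Implicit Arguments.
Unset Strict Implicit.
Unset Printing Implicit Defensive.

(** The maps A and B are quadratic in theta, with convex second-order parts for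
    the Loewner order, and f is a positive definite quadratic form.  Write
    G t s = B s - A t - dA(t) (s - t), so that C(t) = {s | G t s <= 0}.

    A lies above its tangents, hence G s s <= G t s: every point of C(t) is
    feasible for the original problem ([qform_G_majorizes]), and a feasible t
    belongs to C(t).  C(t) is convex, so minimality of s = S(t) over C(t) gives
    f(s) + f(t - s) <= f(t) ([argmin_descent]).  Thus f decreases along the
    iterates, they stay in a compact sublevel set, and their steps tend to 0; by
    Ostrowski's theorem the accumulation points form a connected compact set
    ([accumulation_dichotomy]).

    It remains to see that an accumulation point t is stationary.  If some s with
    f(s) < f(t) were strictly feasible for G t, it would be feasible for G at all
    iterates close to t, and the next iterate would have a value at most
    f(s) < f(t), although all values are at least f(t).  That no such s exists
    implies the existence of a multiplier ([no_descent_stationary]): minimise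
    over the positive semidefinite matrices Lam the defect
    |grad f + L^* Lam|^2 + tr (G0 Lam)^2, where L = dB(t) - dA(t) and
    G0 = B(t) - A(t).  Slater's condition makes the defect coercive, and a
    minimiser with nonzero defect yields a descent direction that keeps the
    linearised constraint ([multiplier_alternative]).  Tilting it slightly
    towards a Slater point produces a forbidden s.

    Slater points exist for every t: take M = I and p large ([slater_point]).
    Positive definiteness of f rests on the positive semidefiniteness of the
    invertible Gram matrices; for H, which is built from mixed derivatives, this
    and the symmetry are obtained by passing to the limit in second differences
    of the kernel ([psdmx_gram_mixed_deriv]). *)

(** * Positive semidefinite matrices *)

Section SemidefiniteMatrices.
Context {R : realType}.

Definition qform q (A : 'M[R]_q) (v : 'cV[R]_q) : R := (v^T *m A *m v) 0 0.

Lemma mx11_tr (a : 'M[R]_1) : a 0 0 = \tr a.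
Proof. by rewrite /mxtrace big_ord_recl big_ord0 addr0. Qed.

Lemma qformE q (A : 'M[R]_q) v : qform A v = \tr (A *m (v *m v^T)).
Proof. by rewrite /qform mx11_tr -mulmxA mxtrace_mulC mulmxA. Qed.

Lemma qform_sum q (A : 'M[R]_q) v :
  qform A v = \sum_i \sum_j A i j * (v i 0 * v j 0).
Proof.
rewrite qformE /mxtrace; apply: eq_bigr => i _; rewrite mxE.
by apply: eq_bigr => j _; rewrite !mxE big_ord_recl big_ord0 !mxE addr0 (mulrC (v j 0)).
Qed.

Lemma qformD q (A B : 'M[R]_q) v : qform (A + B) v = qform A v + qform B v.
Proof. by rewrite !qformE mulmxDl mxtraceD. Qed.

Lemma qformB q (A B : 'M[R]_q) v : qform (A - B) v = qform A v - qform B v.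
Proof. by rewrite !qformE mulmxBl raddfB. Qed.

Lemma qformN q (A : 'M[R]_q) v : qform (- A) v = - qform A v.
Proof. by rewrite !qformE mulNmx raddfN. Qed.

Lemma qformZ q a (A : 'M[R]_q) v : qform (a *: A) v = a * qform A v.
Proof. by rewrite !qformE -scalemxAl mxtraceZ. Qed.

Lemma psdmx0 q : psdmx (0 : 'M[R]_q).
Proof. by split=> [|v]; rewrite ?trmx0 // mulmx0 mul0mx mxE. Qed.

Lemma psdmxD q (A B : 'M[R]_q) : psdmx A -> psdmx B -> psdmx (A + B).
Proof.
move=> [sA pA] [sB pB]; split; first by rewrite linearD /= sA sB.
by move=> v; rewrite -/(qform _ v) qformD addr_ge0 ?pA ?pB.
Qed.

Lemma psdmxZ q a (A : 'M[R]_q) : 0 <= a -> psdmx A -> psdmx (a *: A).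
Proof.
move=> a0 [sA pA]; split; first by rewrite linearZ /= sA.
by move=> v; rewrite -/(qform _ v) qformZ mulr_ge0 ?pA.
Qed.

Lemma psdmx_gram m q (W : 'M[R]_(m, q)) : psdmx (W^T *m W).
Proof.
split=> [|v]; first by rewrite trmx_mul trmxK.
rewrite mulmxA -trmx_mul -mulmxA mxE sumr_ge0 // => i _.
by rewrite mxE -expr2 sqr_ge0.
Qed.

Lemma psdmx_block p q (A : 'M[R]_p) (D : 'M[R]_q) :
  psdmx A -> psdmx D -> psdmx (block_mx A 0 0 D).
Proof.
move=> [sA pA] [sD pD]; split; first by rewrite tr_block_mx sA sD !trmx0.
move=> v; rewrite -[v]vsubmxK tr_col_mx mul_row_block mul_row_col.
by rewrite !mulmx0 addr0 add0r mxE addr_ge0.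
Qed.

Lemma psdmx_diag m (p : 'I_m -> nat) (D : forall i, 'M[R]_(p i)) :
  (forall i, psdmx (D i)) -> psdmx (\mxdiag_i D i).
Proof.
move=> pD; split.
  by rewrite tr_mxdiag; apply: eq_mxdiag => i; case: (pD i).
move=> v; rewrite -[v]submxcolK tr_mxcol mul_mxrow_mxdiag mul_mxrow_mxcol.
by rewrite summxE sumr_ge0 // => i _; case: (pD i).
Qed.

(** Cholesky: clearing the first row and column leaves the Schur complement,
    which is again positive semidefinite; if the pivot vanishes so does its
    row. *)
Lemma psdmx_factor q (A : 'M[R]_q) : psdmx A -> exists W : 'M[R]_q, A = W^T *m W.
Proof.
elim: q A => [|q IH] A; first by exists 0; apply/matrixP => -[].
rewrite -[q.+1]/(1 + q)%N in A *.
move: (ulsubmx A) (ursubmx A) (dlsubmx A) (drsubmx A) (submxK A) =>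
  a b b' D <- {A} [].
rewrite tr_block_mx => /eq_block_mx [_ _ b'E sD] pA.
rewrite -{}b'E in pA *.
pose al := a 0 0; have aE : a = al%:M by rewrite [LHS]mx11_scalar.
have vE (s : R) (v : 'cV[R]_q) :
    0 <= s ^+ 2 * al + s * 2 * (b *m v) 0 0 + qform D v.
  have := pA (col_mx s%:M v); rewrite tr_col_mx mul_row_block mul_row_col.
  rewrite aE tr_scalar_mx !mulmxDl !mul_scalar_mx -!mulmxA !mul_mx_scalar.
  rewrite -scalemxAr -scalemxAl -trmx_mul /qform -mulmxA.
  move: (b *m v) (v^T *m (D *m v)) => x y; rewrite !mxE !mulr1n.
  by have -> : s * (s * al) + s * x 0 0 + (s * x 0 0 + y 0 0) =
    s ^+ 2 * al + s * 2 * x 0 0 + y 0 0 by ring.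
have al0 : 0 <= al.
  by have := vE 1 0; rewrite mulmx0 /qform mulmx0 !mxE expr1n mul1r mulr0 !addr0.
have sDu (c : R) : (D - c *: (b^T *m b))^T = D - c *: (b^T *m b).
  by rewrite linearB linearZ /= trmx_mul trmxK sD.
have qb (v : 'cV[R]_q) : qform (b^T *m b) v = (b *m v) 0 0 ^+ 2.
  rewrite /qform mulmxA -trmx_mul -mulmxA mxE big_ord_recl big_ord0 addr0 mxE.
  by rewrite expr2.
have [al_eq0|al_neq0] := eqVneq al 0.
  have b0 : b = 0.
    apply/rowP => j; rewrite mxE; set v : 'cV[R]_q := delta_mx j 0.
    have bv : (b *m v) 0 0 = b 0 j.
      by rewrite -colE mxE.
    have [//|bj] := eqVneq (b 0 j) 0.
    (* with this coefficient the form would take the value -1 *)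
    have := vE (- (qform D v + 1) / (2 * b 0 j)) v.
    rewrite al_eq0 bv mulr0 add0r.
    have -> : - (qform D v + 1) / (2 * b 0 j) * 2 * b 0 j = - (qform D v + 1).
      by field.
    lra.
  have [|W WE] := IH D.
    by split=> // v; have := vE 0 v; rewrite expr0n /= !mul0r !add0r.
  exists (block_mx 0 0 0 W).
  rewrite tr_block_mx mulmx_block !trmx0 !mul0mx !mulmx0 !addr0 !add0r -WE.
  by rewrite aE al_eq0 b0 trmx0 raddf0.
have algt0 : 0 < al by rewrite lt_def al_neq0.
have [|W WE] := IH (D - al^-1 *: (b^T *m b)).
  split=> [|v]; first exact: sDu.
  rewrite -/(qform _ v) qformB qformZ qb.
  have := vE (- al^-1 * (b *m v) 0 0) v; congr (0 <= _); by field.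
pose r := Num.sqrt al; have r0 : r != 0 by rewrite gt_eqF // sqrtr_gt0.
have rr : r * r = al by rewrite -expr2 sqr_sqrtr.
exists (block_mx r%:M (r^-1 *: b) 0 W).
rewrite tr_block_mx mulmx_block trmx0 !mulmx0 !mul0mx !addr0 -WE.
rewrite tr_scalar_mx -scalar_mxM rr aE !linearZ /= mul_scalar_mx scalerA.
rewrite mulVf // scale1r mul_mx_scalar scalerA mulfV // scale1r -scalemxAl.
by rewrite scalerA -invfM rr scalerN addrC subrK.
Qed.

Lemma sqnorm_ge0 m q (X : 'M[R]_(m, q)) : 0 <= \tr (X^T *m X).
Proof.
rewrite /mxtrace sumr_ge0 // => i _; rewrite mxE sumr_ge0 // => j _.
by rewrite mxE -expr2 sqr_ge0.
Qed.

Lemma sqnorm_eq0 m q (X : 'M[R]_(m, q)) : \tr (X^T *m X) = 0 -> X = 0.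
Proof.
have ge0 i : 0 <= (X^T *m X) i i.
  by rewrite mxE sumr_ge0 // => j _; rewrite mxE -expr2 sqr_ge0.
move=> /eqP; rewrite /mxtrace psumr_eq0; last by move=> i _; exact: ge0.
move=> /allP X0; apply/matrixP => k i; rewrite mxE.
have := X0 i (mem_index_enum i); rewrite /= mxE psumr_eq0; last first.
  by move=> j _; rewrite mxE -expr2 sqr_ge0.
move=> /allP /(_ k (mem_index_enum k)).
by rewrite /= mxE mulf_eq0 orbb => /eqP.
Qed.

Lemma tr_psdmx_ge0 q (A B : 'M[R]_q) : psdmx A -> psdmx B -> 0 <= \tr (A *m B).
Proof.
move=> /psdmx_factor[U ->] /psdmx_factor[W ->].
rewrite mulmxA mxtrace_mulC !mulmxA -[W *m U^T]trmxK trmx_mul trmxK.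
by rewrite -mulmxA sqnorm_ge0.
Qed.

Lemma psdmx_unit_qform_gt0 q (A : 'M[R]_q) (v : 'cV[R]_q) :
  psdmx A -> A \in unitmx -> v != 0 -> 0 < qform A v.
Proof.
move=> pA uA v0; rewrite lt_def (proj2 pA) andbT; apply: contra v0.
have [W AE] := psdmx_factor pA.
have -> : qform A v = \tr ((W *m v)^T *m (W *m v)).
  by rewrite /qform mx11_tr AE trmx_mul !mulmxA.
move=> /eqP /sqnorm_eq0 Wv; apply/eqP.
by rewrite -[v](mulKmx uA) AE -mulmxA Wv !mulmx0.
Qed.

(** If A = W^T W then tr (A M A M^T) is the squared Frobenius norm of
    W M W^T, and W M W^T = 0 forces A M A = 0. *)
Lemma psdmx_unit_conj_gt0 q (A M : 'M[R]_q) :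
  psdmx A -> A \in unitmx -> M != 0 -> 0 < \tr (A *m M *m A *m M^T).
Proof.
move=> pA uA M0; have [W AE] := psdmx_factor pA.
have -> : \tr (A *m M *m A *m M^T) =
    \tr ((W *m M^T *m W^T)^T *m (W *m M^T *m W^T)).
  rewrite !trmx_mul !trmxK AE -!mulmxA mxtrace_mulC -!mulmxA.
  by rewrite mxtrace_mulC !mulmxA mxtrace_mulC !mulmxA.
rewrite lt_def sqnorm_ge0 andbT; apply: contra M0 => /eqP /sqnorm_eq0 WMW.
have AMA : A *m M^T *m A = 0.
  have -> : A *m M^T *m A = W^T *m (W *m M^T *m W^T) *m W by rewrite AE !mulmxA.
  by rewrite WMW mulmx0 mul0mx.
apply/eqP/trmx_inj; rewrite trmx0 -[M^T](mulKmx uA) -[A *m M^T](mulmxK uA) AMA.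
by rewrite mul0mx mulmx0.
Qed.

(** With A = W^T W, the entry A i j is an inner product of columns of W, so it is
    at most half the sum of two diagonal entries. *)
Lemma psdmx_entry_le q (A : 'M[R]_q) i j : psdmx A -> `|A i j| <= \tr A.
Proof.
move=> /psdmx_factor[W ->].
have col_le k : \sum_l W l k ^+ 2 <= \tr (W^T *m W).
  rewrite [leRHS](bigD1 k) //= mxE.
  under [X in _ <= X + _]eq_bigr do rewrite mxE -expr2.
  rewrite lerDl sumr_ge0 // => l _; rewrite mxE sumr_ge0 // => m _.
  by rewrite mxE -expr2 sqr_ge0.
rewrite mxE; under eq_bigr do rewrite mxE.
apply: le_trans (_ : \sum_l (W l i ^+ 2 + W l j ^+ 2) / 2 <= _).
  apply: (le_trans (ler_norm_sum _ _ _)); apply: ler_sum => l _.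
  rewrite normrM -(real_normK (num_real (W l i))) -(real_normK (num_real (W l j))).
  have := sqr_ge0 (`|W l i| - `|W l j|); set x := `|_|; set y := `|_|; nra.
rewrite -mulr_suml big_split /= ler_pdivrMr //.
by rewrite mulr_natr mulr2n lerD.
Qed.

Lemma tr_psdmx_normle q (A : 'M[R]_q) : psdmx A -> `|A| <= \tr A.
Proof.
move=> pA; rewrite [leLHS]/Num.norm /= mx_normrE; apply/bigmax_leP; split.
  by have [W ->] := psdmx_factor pA; exact: sqnorm_ge0.
by move=> [i j] _; exact: psdmx_entry_le.
Qed.

Lemma mx_entry_le m q (A : 'M[R]_(m, q)) i j : `|A i j| <= `|A|.
Proof.
rewrite [leRHS]/Num.norm /= mx_normrE.
exact: (le_bigmax _ (fun ij => `|A ij.1 ij.2|) (i, j)).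
Qed.

Lemma psdmx_norm q (K : 'M[R]_q) : K^T = K -> psdmx ((q%:R * `|K|)%:M - K).
Proof.
move=> sK; split; first by rewrite linearB /= tr_scalar_mx sK.
move=> v; rewrite -/(qform _ v) qformB subr_ge0.
have -> : qform (q%:R * `|K|)%:M v = \sum_i \sum_j `|K| * ((v i 0 ^+ 2 + v j 0 ^+ 2) / 2).
  rewrite /qform mul_mx_scalar -scalemxAl !mxE.
  under [in RHS]eq_bigr => i _ do rewrite -mulr_sumr -mulr_suml big_split /= sumr_const card_ord.
  rewrite -mulr_sumr -mulr_suml big_split /= sumrMnl sumr_const card_ord.
  under eq_bigr => i _ do rewrite mxE -expr2.
  by rewrite -[in RHS]mulr_natr; field.
rewrite qform_sum; apply: ler_sum => i _; apply: ler_sum => j _.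
apply: (le_trans (ler_norm _)); rewrite normrM; apply: ler_pM => //.
  exact: mx_entry_le.
rewrite normrM -(real_normK (num_real (v i 0))) -(real_normK (num_real (v j 0))).
have := sqr_ge0 (`|v i 0| - `|v j 0|); set x := `|_|; set y := `|_|; nra.
Qed.

End SemidefiniteMatrices.

(** * Finite-dimensional normed spaces *)

Section FiniteDimension.
Context {R : realType}.

Definition linear_of (U V : lmodType R) (f : U -> V) (lf : linear f) :
  {linear U -> V} := HB.pack f (GRing.isLinear.Build _ _ _ _ f lf).

Definition bilin (U V W : lmodType R) (b : U -> V -> W) : Prop :=
  (forall u, linear (b u)) /\ (forall v, linear (b^~ v)).

Section Bilinear.
Context {U V W : lmodType R} {b : U -> V -> W} (bb : bilin b).

Lemma bilinDr u v w : b u (v + w) = b u v + b u w.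
Proof. exact: (linearD (linear_of (proj1 bb u))). Qed.
Lemma bilinZr a u v : b u (a *: v) = a *: b u v.
Proof. exact: (linearZZ (linear_of (proj1 bb u))). Qed.
Lemma bilinDl u v w : b (u + v) w = b u w + b v w.
Proof. exact: (linearD (linear_of (proj2 bb w))). Qed.
Lemma bilinZl a u v : b (a *: u) v = a *: b u v.
Proof. exact: (linearZZ (linear_of (proj2 bb v))). Qed.

End Bilinear.

Lemma bilin_add (U V W : lmodType R) (b b' : U -> V -> W) :
  bilin b -> bilin b' -> bilin (fun u v => b u v + b' u v).
Proof.
move=> [br bl] [br' bl']; split=> w a s t /=.
  by rewrite br br' scalerDr addrACA.
by rewrite (bl w) (bl' w) /= scalerDr addrACA.
Qed.

(** Products and matrix spaces carry such coordinates, whatever norm is put on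
    them; the continuity of phi follows from that of linear maps on row
    vectors. *)
Definition findim (V : normedModType R) : Prop :=
  exists d (psi : {linear V -> 'rV[R]_d}) (phi : {linear 'rV[R]_d -> V}),
    [/\ continuous psi, cancel psi phi & cancel phi psi].

Lemma mx_continuous (T : topologicalType) m n (f : T -> 'M[R]_(m, n)) :
  (forall i j, continuous (fun t => f t i j)) -> continuous f.
Proof.
move=> cf t; apply/(@cvgrPdist_lt _ 'M[R]_(m, n)) => e e0.
have : \forall s \near t, forall ij, ij \in index_enum ('I_m * 'I_n)%type ->
    `|f t ij.1 ij.2 - f s ij.1 ij.2| < e.
  elim: (index_enum _) => [|[i j] r IH]; first by apply: nearW => s ij.
  have cij : \forall s \near t, `|f t i j - f s i j| < e.
    exact: (@cvgr_dist_lt _ _ _ _ _ (fun s => f s i j) _ (cf i j t)).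
  near=> s => ij; rewrite inE => /predU1P[-> /=|]; first by near: s.
  by move: ij; near: s.
apply: filterS => s fs; rewrite [ltLHS]/Num.norm /= mx_normrE.
apply/bigmax_ltP; split=> // ij _; rewrite !mxE; apply: fs.
exact: mem_index_enum.
Unshelve. all: by end_near. Qed.

Lemma rV_linear_continuous d (W : normedModType R) (g : {linear 'rV[R]_d -> W}) :
  continuous g.
Proof.
have -> : (g : _ -> _) = (fun v => \sum_(j < d) v 0 j *: g (delta_mx 0 j)).
  by apply/funext => v; rewrite {1}[v]row_sum_delta linear_sum /=;
     apply: eq_bigr => j _; rewrite linearZ.
apply: continuous_big => [|j _ v]; first exact: add_continuous.
exact: cvgZr_tmp (@coord_continuous R 1 d 0 j v).
Qed.

Lemma findim_mx m n : findim 'M[R]_(m, n).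
Proof.
exists (m * n)%N, (mxvec : {linear 'M[R]_(m, n) -> _}), (vec_mx : {linear _ -> 'M[R]_(m, n)}).
split; [|exact: mxvecK|exact: vec_mxK].
apply: mx_continuous => i k; rewrite ord1; case/mxvec_indexP: k => a b.
under [X in continuous X]eq_fun do rewrite mxvecE.
exact: coord_continuous.
Qed.

Lemma findim_linear_continuous (V W : normedModType R) (g : V -> W) :
  findim V -> linear g -> continuous g.
Proof.
move=> [d [psi [phi [cpsi psiK _]]]] lg.
pose gL := linear_of lg.
have -> : g = (gL \o phi) \o psi by apply/funext => v /=; rewrite psiK.
move=> v; apply: continuous_comp; first exact: cpsi.
exact: (@rV_linear_continuous d W (gL \o phi : {linear _ -> _})).
Qed.

Lemma findim_prod (U V : normedModType R) :
  findim U -> findim V -> findim (U * V)%type.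
Proof.
move=> [d [psi [phi [cpsi psiK phiK]]]] [e [xi [zeta [cxi xiK zetaK]]]].
have lin1 : linear (fun p : U * V => row_mx (psi p.1) (xi p.2)).
  by move=> a p q; rewrite scale_row_mx add_row_mx -!linearP.
have lin2 : linear (fun w : 'rV[R]_(d + e) => (phi (lsubmx w), zeta (rsubmx w))).
  by move=> a p q; rewrite !linearP.
exists (d + e)%N, (linear_of lin1), (linear_of lin2); split => /=.
- apply: mx_continuous => i k; rewrite ord1.
  case: (splitP k) => j kj.
    have -> : k = lshift e j by exact: val_inj.
    under [X in continuous X]eq_fun do rewrite row_mxEl.
    move=> p; apply: (@continuous_comp _ _ _ (fun q : U * V => psi q.1) (fun v : 'rV_d => v 0 j)).
      by apply: continuous_comp; [exact: cvg_fst|exact: cpsi].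
    exact: coord_continuous.
  have -> : k = rshift d j by exact: val_inj.
  under [X in continuous X]eq_fun do rewrite row_mxEr.
  move=> p; apply: (@continuous_comp _ _ _ (fun q : U * V => xi q.2) (fun v : 'rV_e => v 0 j)).
    by apply: continuous_comp; [exact: cvg_snd|exact: cxi].
  exact: coord_continuous.
- by move=> [u v] /=; rewrite row_mxKl row_mxKr psiK xiK.
- by move=> w /=; rewrite phiK zetaK hsubmxK.
Qed.

Lemma findim_bilin_continuous (U V W : normedModType R) (b : U -> V -> W) :
  findim U -> findim V -> bilin b -> continuous (fun p : U * V => b p.1 p.2).
Proof.
move=> [d [psi [phi [cpsi psiK _]]]] fV [lr ll].
have -> : (fun p : U * V => b p.1 p.2) =
    (fun p => \sum_(j < d) psi p.1 0 j *: b (phi (delta_mx 0 j)) p.2).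
  apply/funext => p; rewrite -{1}(psiK p.1) {1}[psi p.1]row_sum_delta linear_sum.
  rewrite -[LHS]/(linear_of (ll p.2) _) linear_sum; apply: eq_bigr => j _.
  by rewrite !linearZ.
apply: continuous_big => [|j _ p]; first exact: add_continuous.
apply: cvgZ.
  apply: (@continuous_comp _ _ _ (fun q : U * V => psi q.1) (fun v : 'rV_d => v 0 j)).
    by apply: continuous_comp; [exact: cvg_fst|exact: cpsi].
  exact: coord_continuous.
apply: continuous_comp; first exact: cvg_snd.
exact: (findim_linear_continuous fV (lr _)).
Qed.

Lemma linear_comp_continuous (V W : normedModType R) (g : V -> W)
    (X : topologicalType) (u : X -> V) :
  findim V -> linear g -> continuous u -> continuous (fun x => g (u x)).
Proof.
move=> fV lg cu x.
apply: (@continuous_comp _ _ _ u g); first exact: cu.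
exact: findim_linear_continuous.
Qed.

Lemma bilin_comp_continuous (U V W : normedModType R) (b : U -> V -> W)
    (X : topologicalType) (u : X -> U) (w : X -> V) :
  findim U -> findim V -> bilin b -> continuous u -> continuous w ->
  continuous (fun x => b (u x) (w x)).
Proof.
move=> fU fV bb cu cw x.
have cb := findim_bilin_continuous fU fV bb.
exact: (continuous_comp (cvg_pair (cu x) (cw x)) (cb (u x, w x))).
Qed.

(** Heine-Borel, transported from row vectors. *)
Lemma findim_compact (V : normedModType R) (A : set V) (M : R) :
  findim V -> closed A -> (forall v, A v -> `|v| <= M) -> compact A.
Proof.
move=> [d [psi [phi [cpsi psiK phiK]]]] cA bA.
have cphi : continuous phi by exact: rV_linear_continuous.
have -> : A = phi @` (phi @^-1` A).
  apply/seteqP; split=> [v Av|_ [w Aw <-]] //.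
  by exists (psi v); rewrite /= psiK.
apply: continuous_compact; first exact/continuous_subspaceT.
apply: bounded_closed_compact; last exact: (closed_comp (fun w _ => cphi w) cA).
have /linear_bounded_continuous/linear_boundedP[K [_ Kb]] := cpsi.
have := Kb (K + 1); rewrite ltrDl ltr01 => /(_ isT) {}Kb.
exists (`|K + 1| * M); split; first exact: num_real.
move=> y My w Aw; rewrite -[w]phiK; apply: (le_trans (Kb _)).
apply/ltW/(le_lt_trans _ My)/(le_trans (_ : _ <= `|K + 1| * `|phi w|)).
  by rewrite ler_wpM2r // ler_norm.
by rewrite ler_wpM2l // bA.
Qed.

(** The diagonal value of a continuous bilinear map is o(|h|), so the linear
    part of b t t + l t + c is its differential. *)
Lemma diff_quadratic (V W : normedModType R) (b : V -> V -> W) (l : V -> W)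
    (c : W) (t : V) :
  findim V -> bilin b -> linear l ->
  'd (fun s => b s s + l s + c) t = (fun h => b t h + b h t + l h) :> (V -> W).
Proof.
move=> fV bb ll; have cb := findim_bilin_continuous fV fV bb.
have [lr lf] := bb.
have lind : linear (fun h => b t h + b h t + l h).
  move=> a h k; rewrite lr lf ll /= !scalerDr.
  by rewrite [X in X + _ = _]addrACA [LHS]addrACA.
rewrite -[RHS]/(linear_of lind : V -> W); apply: diff_unique.
  exact: (findim_linear_continuous fV lind).
apply/eqaddoP => e e0.
have bi : bilinear_for *:%R *:%R b by split=> u; [exact: lf|exact: lr].
pose bL : {bilinear V -> V -> W} :=
  HB.pack b (bilinear_isBilinear.Build _ _ _ _ _ _ b bi).
have [K K0 bK] := @bilinear_schwarz _ _ _ _ bL cb.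
near=> h; rewrite /= [leLHS](_ : _ = `|b h h|); last first.
  congr `|_|; rewrite -[LHS]/(b (h + t) (h + t) + l (h + t) + c -
    (b t t + l t + c + (b t h + b h t + l h))).
  have lD : l (h + t) = l h + l t by exact: (linearD (linear_of ll)).
  rewrite !(bilinDl bb) !(bilinDr bb) lD.
  move: (b h h) (b h t) (b t h) (b t t) (l h) (l t) => a1 a2 a3 a4 a5 a6.
  apply/eqP; rewrite subr_eq !addrA; apply/eqP.
  by rewrite [LHS](ACl (1*4*6*7*3*2*5)).
apply: (le_trans (bK h h)); rewrite ler_wpM2r //.
rewrite -ler_pdivlMl //; near: h; apply/nbhs_norm0P.
by exists (K^-1 * e); rewrite /= ?mulr_gt0 ?invr_gt0 // => h /ltW.
Unshelve. all: by end_near. Qed.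

(** By homogeneity it is enough to bound q below on the unit sphere, which is
    compact. *)
Lemma posdef_lower_bound (V : normedModType R) (q : V -> R) :
  findim V -> continuous q -> (forall a v, q (a *: v) = a ^+ 2 * q v) ->
  (forall v, v != 0 -> 0 < q v) ->
  exists2 m, 0 < m & forall v, m * `|v| ^+ 2 <= q v.
Proof.
move=> fV cq qZ qpos; pose S : set V := [set v | `|v| = 1].
have q0 : q 0 = 0 by rewrite -(scale0r (0 : V)) qZ expr0n mul0r.
have cS : closed S.
  rewrite -[S]/((fun v : V => `|v|) @^-1` [set 1]).
  by apply: closed_comp; [move=> *; exact: norm_continuous|exact: closed_eq].
have [S0|S0] := pselect (S !=set0); last first.
  exists 1 => // v; have [->|v0] := eqVneq v 0.
    by rewrite normr0 expr0n mulr0 q0.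
  exfalso; apply: S0; exists (`|v|^-1 *: v).
  by rewrite /S /= normrZ normfV normr_id mulVf // normr_eq0.
have cptS : compact S by apply: (findim_compact (M := 1) fV cS) => v ->.
have [w Sw wmin] := compact_EVT_min S0 cptS (continuous_subspaceT cq).
rewrite inE in Sw; exists (q w).
  apply: qpos; apply/eqP => w0; move: Sw.
  by rewrite /S /= w0 normr0 => /eqP; rewrite eq_sym oner_eq0.
move=> v; have [->|v0] := eqVneq v 0.
  by rewrite normr0 expr0n mulr0 q0.
have nv : `|v| != 0 by rewrite normr_eq0.
rewrite -[v in leRHS](scalerKV nv) qZ mulrC ler_wpM2l ?sqr_ge0 //.
by apply: wmin; rewrite inE /S /= normrZ normfV normr_id mulVf.
Qed.

End FiniteDimension.

(** * Accumulation points of sequences with vanishing steps *)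

Section AccumulationPoints.
Context {R : realType} {V : normedModType R}.
Variables (theta : nat -> V) (K : set V).
Hypothesis cptK : compact K.
Hypothesis thetaK : \forall k \near \oo, K (theta k).

Lemma clusterP t : cluster (theta @ \oo) t <->
  forall B, nbhs t B -> ~ \forall k \near \oo, ~ B (theta k).
Proof.
split=> [ct B tB nB|H A B nA tB].
  by have [s [sA sB]] := ct (~` B) B nB tB.
have {}nA : \forall k \near \oo, A (theta k) by [].
apply: contrapT => AB; apply: (H B tB); apply: filterS nA => k Ak Bk.
by apply: AB; exists (theta k).
Qed.

Lemma cluster_closed (A : set V) t : closed A ->
  (\forall k \near \oo, A (theta k)) -> cluster (theta @ \oo) t -> A t.
Proof. by move=> cA nA; rewrite clusterE => /(_ A nA); apply: cA. Qed.

(** Compactness for the subsequence of the indices satisfying J, expressed on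
    the filter of large indices in J. *)
Lemma frequently_cluster (J : nat -> Prop) :
  ~ (\forall k \near \oo, ~ J k) ->
  exists y, K y /\
    forall B, nbhs y B -> ~ (\forall k \near \oo, ~ (J k /\ B (theta k))).
Proof.
move=> frJ; have pF : ProperFilter (within J \oo).
  apply: Build_ProperFilter_ex => P; rewrite /within /= => PJ.
  apply: contrapT => nP; apply: frJ; apply: filterS PJ => k JP Jk.
  by apply: nP; exists k; exact: JP.
have KF : (theta @ within J \oo) K.
  by rewrite /= /within /=; apply: filterS thetaK.
have [y [Ky cy]] := @cptK _ (fmap_proper_filter theta pF) KF; exists y; split=> // B yB nB.
suff nJB : (theta @ within J \oo) (~` B) by have [s [sB]] := cy _ _ nJB yB.
by rewrite /= /within /=; apply: filterS nB => k JB Jk Bk; apply: JB.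
Qed.

Lemma cluster_nonempty : cluster (theta @ \oo) !=set0.
Proof.
have [|y [_ yB]] := @frequently_cluster (fun=> True).
  by move=> H; have /filter_ex[k] : \forall k \near \oo, ~ True by [].
exists y; apply/clusterP => B /yB nB nB'; apply: nB.
by apply: filterS nB' => k nBk [].
Qed.

Lemma cluster_compact : compact (cluster (theta @ \oo)).
Proof.
apply: (subclosed_compact _ cptK).
  by rewrite clusterE; apply: closed_bigI => A _; exact: closed_closure.
move=> t; apply: cluster_closed => //; apply: compact_closed => //.
Qed.

Lemma unique_cluster_cvg t :
  cluster (theta @ \oo) `<=` [set t] -> theta @ \oo --> t.
Proof.
move=> ct U tU; apply: contrapT => nU.
have [|y [_ yB]] := @frequently_cluster (fun k => ~ U (theta k)).
  by move=> H; apply: nU; apply: filterS H => k; exact: contrapT.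
have yt : y = t.
  apply: ct; apply/clusterP => B /yB nB nB'; apply: nB.
  by apply: filterS nB' => k nBk [].
move: yB; rewrite yt => /(_ U tU); apply.
by apply: nearW => k [].
Qed.

(** Ostrowski: if the accumulation points split into two disjoint closed
    parts with disjoint neighbourhoods U and V, the sequence leaves U
    infinitely often; the terms from which it leaves accumulate at a point of
    the first part, whose neighbourhood U cannot be left by arbitrarily small
    steps. *)
Lemma cluster_connected :
  (fun k => theta k.+1 - theta k) @ \oo --> (0 : V) ->
  connected (cluster (theta @ \oo)).
Proof.
move=> step; apply/connectedP => E [E0 EU [sep1 sep2]].
have cl : closed (cluster (theta @ \oo)).
  by rewrite clusterE; apply: closed_bigI => A _; exact: closed_closure.
have clE b : closed (E b).
  move=> t Et; have : cluster (theta @ \oo) t.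
    by apply: cl; apply: closureS Et; rewrite EU; case: (b); [right|left].
  rewrite EU; case: b Et => Et [] // Ebt; exfalso.
    by have : (E false `&` closure (E true)) t by []; rewrite sep2.
  by have : (closure (E false) `&` E true) t by []; rewrite sep1.
have /normal_openP/(_ _ _ (clE false) (clE true)) := @pseudometric_normal R V.
have disj : E false `&` E true = set0 by apply: separated_disjoint.
move=> /(_ R disj)[U [W [oU oW EfU EtW UW]]].
have UWF t : U t -> W t -> False.
  by move=> Ut Wt; have : (U `&` W) t by []; rewrite UW.
have [|y [_ yB]] := @frequently_cluster (fun k => U (theta k) /\ ~ U (theta k.+1)).
  move=> [n _ nJ]; have [a Ea] := E0 false; have [b Eb] := E0 true.
  have /clusterP ca : cluster (theta @ \oo) a by rewrite EU; left.
  have /clusterP cb : cluster (theta @ \oo) b by rewrite EU; right.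
  apply: (ca U); first by apply: open_nbhs_nbhs; split=> //; exact: EfU.
  exists n => // k /= nk Uk.
  have Um m : U (theta (k + m)%N).
    elim: m => [|m IH]; first by rewrite addn0.
    apply: contrapT => nU; apply: (nJ (k + m)%N); last by rewrite -addnS.
    exact: (leq_trans nk (leq_addr _ _)).
  apply: (cb W); first by apply: open_nbhs_nbhs; split=> //; exact: EtW.
  by exists k => // m /= km Wm; apply: (UWF _ _ Wm); rewrite -(subnKC km).
have cy : cluster (theta @ \oo) y.
  apply/clusterP => B /yB nB nB'; apply: nB.
  by apply: filterS nB' => k nBk [].
have yU : U y.
  move: cy; rewrite EU => -[/EfU //|/EtW Wy]; exfalso.
  apply: (yB W); first exact: open_nbhs_nbhs.
  by apply: nearW => k [[Uk _] Wk]; exact: (UWF _ Uk Wk).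
have /nbhs_ballP[e /= e0 yeU] : nbhs y U by exact: open_nbhs_nbhs.
apply: (yB (ball y (e / 2))); first by apply: nbhsx_ballx; rewrite divr_gt0.
have /cvgrPdist_lt/(_ (e / 2)) := step; rewrite divr_gt0 // => /(_ isT).
apply: filterS => k; rewrite sub0r normrN => dk [[_ nU] yk]; apply: nU.
apply: yeU; rewrite (splitr e); apply: ball_triangle yk _.
by rewrite -ball_normE /ball_ /= distrC.
Qed.

Lemma accumulation_dichotomy (P : V -> Prop) :
  (fun k => theta k.+1 - theta k) @ \oo --> (0 : V) ->
  (forall t, cluster (theta @ \oo) t -> P t) ->
  converges_to_point_or_continuum theta P.
Proof.
move=> step cP; have [a ca] := cluster_nonempty.
have [sub|nsub] := pselect (cluster (theta @ \oo) `<=` [set a]).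
  by left; exists a; [exact: unique_cluster_cvg|exact: cP].
right; split=> //; split; [exact: cluster_compact|exact: cluster_connected|].
move/existsNP: nsub => [b /not_implyP[cb ba]].
by exists a, b; split=> // ab; apply: ba; rewrite ab.
Qed.

End AccumulationPoints.

(** The decrements of f along the sequence are summable, and they dominate the
    squared step lengths. *)
Lemma descent_steps_vanish {R : realType} {V : normedModType R}
    (theta : nat -> V) (f : V -> R) (m : R) :
  0 < m -> (forall t, m * `|t| ^+ 2 <= f t) ->
  (forall k, f (theta k.+2) + f (theta k.+1 - theta k.+2) <= f (theta k.+1)) ->
  (fun k => theta k.+1 - theta k) @ \oo --> (0 : V).
Proof.
move=> m0 mf descent.
have f_ge0 t : 0 <= f t.
  by apply: le_trans (mf t); rewrite mulr_ge0 ?sqr_ge0 // ltW.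
have cvf : cvgn (fun k => f (theta k.+1)).
  apply: nonincreasing_is_cvgn; last by exists 0 => _ [k _ <-].
  apply/nonincreasing_seqP => k; apply: le_trans (descent k).
  by rewrite lerDl.
have gap0 : (fun k => f (theta k.+1) - f (theta k.+2)) @ \oo --> (0 : R).
  rewrite -(subrr (limn (fun k => f (theta k.+1)))); apply: cvgB => //.
  by have := cvf; rewrite -(cvg_shiftS (fun k => f (theta k.+1))).
rewrite -(cvg_shiftS (fun k => theta k.+1 - theta k)) /=.
apply/cvgrPdist_lt => e e0.
have /cvgrPdist_lt/(_ (m * e ^+ 2)) := gap0.
rewrite mulr_gt0 ?exprn_gt0 // => /(_ isT); apply: filterS => k.
rewrite !sub0r !normrN => gk.
have : m * `|theta k.+1 - theta k.+2| ^+ 2 < m * e ^+ 2.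
  apply: le_lt_trans (mf _) (le_lt_trans _ gk); apply: le_trans (ler_norm _).
  by rewrite lerBrDl.
by rewrite ltr_pM2l // distrC ltr_pXn2r // nnegrE // ltW.
Qed.

(** * Semidefinite inequalities and the Euclidean structure *)

Section Negativity.
Context {R : realType} {q : nat}.
Implicit Types K : 'M[R]_q.

Definition sqlen (v : 'cV[R]_q) : R := \tr (v^T *m v).

Lemma sqlen_ge0 v : 0 <= sqlen v. Proof. exact: sqnorm_ge0. Qed.

Lemma qform_scalar a v : qform a%:M v = a * sqlen v.
Proof. by rewrite /qform mul_mx_scalar -scalemxAl mxE mx11_tr. Qed.

Lemma loewner_le0P K : K^T = K ->
  loewner_le K 0 <-> (forall v, qform K v <= 0).
Proof.
move=> sK; rewrite /loewner_le sub0r; split=> [[_ nK] v|nK].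
  by have := nK v; rewrite mulmxN mulNmx mxE oppr_ge0.
split=> [|v]; first by rewrite linearN /= sK.
by rewrite mulmxN mulNmx mxE oppr_ge0 nK.
Qed.

Lemma qform_le_norm K v : K^T = K -> qform K v <= q%:R * `|K| * sqlen v.
Proof.
move=> /psdmx_norm [_ /(_ v)]; rewrite -/(qform _ v) qformB qform_scalar.
by rewrite subr_ge0.
Qed.

Lemma qform_linear v : linear (fun K => qform K v : R^o).
Proof. by move=> a K K'; rewrite qformD qformZ. Qed.

Lemma closed_qform_le0 (T : topologicalType) (g : T -> 'M[R]_q) :
  continuous g -> closed [set t | forall v, qform (g t) v <= 0].
Proof.
move=> cg.
have -> : [set t | forall v, qform (g t) v <= 0] =
    \bigcap_v ((fun t => qform (g t) v) @^-1` [set x | x <= 0]).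
  by apply/seteqP; split=> [t h v _|t h v]; exact: h.
apply: closed_bigI => v _; apply: closed_comp; last exact: closed_le.
move=> t _; apply: (@continuous_comp _ _ _ g (fun K => qform K v)).
  exact: cg.
exact: (findim_linear_continuous (findim_mx q q) (@qform_linear v)).
Qed.

Lemma closed_psdmx : closed [set K : 'M[R]_q | psdmx K].
Proof.
have -> : [set K : 'M[R]_q | psdmx K] =
    ((fun K : 'M[R]_q => K^T - K) @^-1` [set 0]) `&` [set K | forall v, qform (- K) v <= 0].
  apply/seteqP; split=> K /=.
    move=> [sK pK]; split; first by rewrite sK subrr.
    by move=> v; rewrite /qform mulmxN mulNmx mxE oppr_le0.
  move=> [/eqP sK pK]; split; first by apply/eqP; rewrite -subr_eq0.
  by move=> v; have := pK v; rewrite /qform mulmxN mulNmx mxE oppr_le0.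
apply: closedI.
  apply: closed_comp; last by apply: compact_closed => //; exact: compact_set1.
  move=> K _; apply: (findim_linear_continuous (findim_mx q q)) => a X Y.
  by rewrite linearP /= scalerBr opprD addrACA.
by apply: closed_qform_le0 => K; exact: opp_continuous.
Qed.

(** A strict inequality with slack delta I survives a perturbation of norm
    less than delta / (q + 1). *)
Lemma qform_le0_near (X : topologicalType) (g : X -> 'M[R]_q) x (delta : R) :
  {for x, continuous g} -> (forall y, (g y)^T = g y) -> 0 < delta ->
  (forall v, qform (g x) v <= - delta * sqlen v) ->
  \forall y \near x, forall v, qform (g y) v <= 0.
Proof.
move=> cg sg delta0 gx; have q1 : 0 < q%:R + 1 :> R by rewrite ltr_wpDl.
have : \forall y \near x, `|g x - g y| < delta / (q%:R + 1).
  by apply: (@cvgr_dist_lt _ _ _ _ _ g _ cg); rewrite divr_gt0.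
apply: filterS => y gy v.
have sgB : (g y - g x)^T = g y - g x by rewrite linearB /= !sg.
have : q%:R * `|g y - g x| <= delta.
  rewrite distrC; apply: (@le_trans _ _ ((q%:R + 1) * `|g x - g y|)).
    by rewrite ler_wpM2r // lerDl.
  by rewrite -ler_pdivlMl // mulrC ltW.
have := qform_le_norm v sgB; rewrite qformB.
by have := gx v; have := sqlen_ge0 v; nra.
Qed.

End Negativity.

Section EuclideanStructure.
Context {R : realType} {n N : nat}.
Notation T := (Theta R n N).
Implicit Types s t : T.

Lemma findim_Theta : findim (Theta R n N).
Proof. by do 3![apply: findim_prod; last exact: findim_mx]; exact: findim_mx. Qed.

Lemma ipC s t : ipTheta s t = ipTheta t s.
Proof.
have trC a b (X Y : 'M[R]_(a, b)) : \tr (X^T *m Y) = \tr (Y^T *m X).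
  by rewrite -mxtrace_tr trmx_mul trmxK.
by congr (_ + _ + _ + _); exact: trC.
Qed.

Lemma ipDl s t w : ipTheta (s + t) w = ipTheta s w + ipTheta t w.
Proof.
rewrite /ipTheta /th_p /th_M /th_c /th_v /= !linearD /= !mulmxDl !mxtraceD; ring.
Qed.

Lemma ipZl a s w : ipTheta (a *: s) w = a * ipTheta s w.
Proof.
rewrite /ipTheta /th_p /th_M /th_c /th_v /= !linearZ /= -!scalemxAl !mxtraceZ; ring.
Qed.

Lemma ip_sqrD s t :
  ipTheta (s + t) (s + t) = ipTheta s s + 2 * ipTheta s t + ipTheta t t.
Proof. by rewrite ipDl ![ipTheta _ (s + t)]ipC !ipDl (ipC t s); ring. Qed.

Lemma ip_bilin : bilin (ipTheta : T -> T -> R^o).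
Proof.
split=> w a s t; last by rewrite ipDl ipZl.
by rewrite ipC ipDl ipZl !(ipC _ w).
Qed.

Lemma ip_continuous (X : topologicalType) (u w : X -> T) :
  continuous u -> continuous w -> continuous (fun x => ipTheta (u x) (w x)).
Proof.
exact: (@bilin_comp_continuous R T T R^o ipTheta X u w findim_Theta findim_Theta ip_bilin).
Qed.

Lemma ip_ge0 s : 0 <= ipTheta s s.
Proof. by rewrite /ipTheta !addr_ge0 // sqnorm_ge0. Qed.

Lemma ip_eq0 s : ipTheta s s = 0 -> s = 0.
Proof.
rewrite /ipTheta => /eqP; do 3![rewrite paddr_eq0 ?addr_ge0 ?sqnorm_ge0 // => /andP[]].
case: s => [[[p M] c] v]; rewrite /th_p /th_M /th_c /th_v /=.
by do 3![move=> + /eqP/sqnorm_eq0->]; move=> /eqP/sqnorm_eq0->.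
Qed.

Lemma ip_inj s t : (forall w, ipTheta s w = ipTheta t w) -> s = t.
Proof.
move=> st; apply/subr0_eq/ip_eq0; rewrite ipDl -scaleN1r ipZl st; ring.
Qed.

Lemma adjointP q (L : T -> 'M[R]_q) (lL : linear L) (Lam : 'M[R]_q) (eta : T) :
  ipTheta (adjoint L Lam) eta = \tr (L eta *m Lam).
Proof.
have lin : linear (fun e => \tr (L e *m Lam) : R^o).
  by move=> a s t; rewrite lL mulmxDl -scalemxAl mxtraceD mxtraceZ.
exact: (rieszP (linear_of lin)).
Qed.

Lemma adjoint_linear q (L : T -> 'M[R]_q) (lL : linear L) : linear (adjoint L).
Proof.
move=> a X Y; apply: ip_inj => w; rewrite ipDl ipZl !adjointP //.
by rewrite mulmxDr -scalemxAr mxtraceD mxtraceZ.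
Qed.

End EuclideanStructure.

Lemma small_step_neg {R : realType} (a b : R) : a < 0 ->
  exists2 e, 0 < e & forall t, 0 < t -> t <= e -> a + t * b < 0.
Proof.
move=> a0; have b1 : 0 < `|b| + 1 by rewrite ltr_wpDl.
exists (- a / (`|b| + 1) / 2); first by rewrite !divr_gt0 ?oppr_gt0.
move=> t t0 te; have : t * (`|b| + 1) <= - a / 2.
  by rewrite -ler_pdivlMr // mulrAC.
by have := ler_norm b; nra.
Qed.

(** Divide by t and let t tend to 0; this turns minimality along a segment into
    a first-order condition. *)
Lemma slope_ge0 {R : realType} (a b : R) :
  (forall t, 0 < t -> t <= 1 -> 0 <= t * a + t ^+ 2 * b) -> 0 <= a.
Proof.
move=> H; rewrite leNgt; apply/negP => a0; have [e e0 He] := small_step_neg b a0.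
have m0 : 0 < Num.min e 1 by rewrite lt_min e0 ltr01.
have := H _ m0; rewrite ge_min lexx orbT => /(_ isT).
have := He _ m0; rewrite ge_min lexx => /(_ isT); nra.
Qed.

(** The slack a e delta l produced by the Slater direction absorbs the
    second-order term a^2 k l, and since x <= 0 the terms proportional to x
    only help. *)
Lemma strict_step_arith {R : realType} (x y z w l a e rho delta k : R) :
  0 < a -> 0 < e -> 0 <= l -> x <= 0 ->
  x + z <= - delta * l -> y <= rho * x -> w <= k * l ->
  -1 + a * (e - rho) < 0 -> - (e * delta) + a * (k + 1) < 0 ->
  x + a * (y + e * z) + a * (a * w) <= - (a * a) * l.
Proof.
move=> a0 e0 l0 x0 xz yx wk c1 c2.
have h1 : a * y <= a * (rho * x) by rewrite ler_pM2l.
have h2 : a * (e * z) <= a * (e * (- delta * l - x)).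
  by rewrite !ler_pM2l // lerBrDr addrC.
have h3 : a * (a * w) <= a * (a * (k * l)) by rewrite !ler_pM2l.
have h4 : (1 - a * (e - rho)) * x <= 0 by rewrite mulr_ge0_le0 //; lra.
have h5 : a * l * (- (e * delta) + a * (k + 1)) <= 0.
  by rewrite mulr_ge0_le0 ?mulr_ge0 // ltW.
lra.
Qed.

(** * Lagrange multipliers *)

Section Multipliers.
Context {R : realType} {n N q : nat}.
Notation T := (Theta R n N).
Variables (g d0 : T) (L : T -> 'M[R]_q) (G0 : 'M[R]_q) (delta : R).
Hypothesis lL : linear L.
Hypothesis symL : forall s, (L s)^T = L s.
Hypothesis symG0 : G0^T = G0.
Hypothesis G0_le0 : forall v, qform G0 v <= 0.
Hypothesis delta_gt0 : 0 < delta.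
Hypothesis slater :
  forall v, qform G0 v + qform (L d0) v <= - delta * sqlen v.

(** The defect measures how far Lam is from satisfying the stationarity equation
    g + L^* Lam = 0 together with complementarity. *)
Let residual (Lam : 'M[R]_q) : T := g + adjoint L Lam.
Let slack (Lam : 'M[R]_q) : R := \tr (G0 *m Lam).
Let defect Lam : R := ipTheta (residual Lam) (residual Lam) + slack Lam ^+ 2.

Lemma continuous_defect : continuous defect.
Proof.
have cadj : continuous (adjoint L).
  exact: (findim_linear_continuous (findim_mx q q) (adjoint_linear lL)).
have cres : continuous residual.
  by move=> Lam; exact: (cvgD (cvg_cst _) (cadj Lam)).
have cslack : continuous slack.
  apply: (@findim_linear_continuous _ _ R^o _ (findim_mx q q)) => a X Y.
  by rewrite /slack mulmxDr -scalemxAr mxtraceD mxtraceZ.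
move=> Lam.
exact: (cvgD (ip_continuous cres cres (x:=Lam)) (cvgM (cslack Lam) (cslack Lam))).
Qed.

(** Pairing Lam with Slater's inequality gives
    delta tr Lam <= - <L^* Lam, d0> - tr (G0 Lam), and both terms on the right
    are controlled by the defect. *)
Lemma trace_le_defect Lam : psdmx Lam ->
  delta * \tr Lam <= (defect Lam + ipTheta d0 d0 + 1) / 2 + ipTheta g d0.
Proof.
move=> pL.
have pP : psdmx (- (G0 + L d0) - delta%:M).
  split=> [|v]; first by rewrite !linearB /= linearN linearD /= symG0 symL tr_scalar_mx.
  rewrite -/(qform _ v) qformB qform_scalar -scaleN1r qformZ qformD.
  by have := slater v; lra.
have := tr_psdmx_ge0 pP pL.
rewrite mulmxBl mulNmx mulmxDl mul_scalar_mx raddfB raddfN raddfD /= mxtraceZ.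
rewrite -(adjointP lL) -/(slack Lam).
have -> : ipTheta (adjoint L Lam) d0 = ipTheta (residual Lam) d0 - ipTheta g d0.
  by rewrite ipDl; ring.
have := ip_ge0 (residual Lam + d0); rewrite ip_sqrD.
have := sqr_ge0 (slack Lam + 1); rewrite /defect; lra.
Qed.

Lemma defect_minimizer : exists2 Lam, psdmx Lam &
  forall X, psdmx X -> defect Lam <= defect X.
Proof.
pose D : set 'M[R]_q := [set X | psdmx X] `&` [set X | defect X <= defect 0].
have D0 : D 0 by split=> /=; [exact: psdmx0|].
have cD : closed D.
  apply: closedI; first exact: closed_psdmx.
  apply: (@closed_comp _ _ defect [set x | x <= defect 0]); last exact: closed_le.
  by move=> X _; exact: continuous_defect.
pose M := ((defect 0 + ipTheta d0 d0 + 1) / 2 + ipTheta g d0) / delta.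
have cptD : compact D.
  apply: (findim_compact (M := M) (findim_mx q q) cD) => X [pX dX].
  apply: (le_trans (tr_psdmx_normle pX)); rewrite /M ler_pdivlMr // mulrC.
  by apply: (le_trans (trace_le_defect pX)); have : defect X <= defect 0 by []; lra.
have [|Lam] := compact_EVT_min (ex_intro _ _ D0) cptD (continuous_subspaceT (f := defect) _).
  exact: continuous_defect.
rewrite inE => -[pL dL] Lmin; exists Lam => // X pX.
have [dX|/ltW dX] := leP (defect X) (defect 0); first by apply: Lmin; rewrite inE.
exact: le_trans dL dX.
Qed.

(** The positive semidefinite Lam minimising the defect either satisfies the
    stationarity and complementarity equations exactly, or leaves a residual
    r and a slack rho whose optimality conditions say that -r is a descent
    direction with L (- r) <= rho G0. *)
Lemma multiplier_alternative :
  (exists Lam, [/\ psdmx Lam, g + adjoint L Lam = 0 & \tr (G0 *m Lam) = 0]) \/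
  (exists d rho, [/\ ipTheta g d < 0, rho <= 0 &
     forall v, qform (L d) v <= rho * qform G0 v]).
Proof.
have [Lam pL Lmin] := defect_minimizer.
set r := residual Lam; set rho := slack Lam.
have rE : r = g + adjoint L Lam by [].
have expand X (t : R) : defect (Lam + t *: X) - defect Lam =
    t * (2 * (ipTheta r (adjoint L X) + rho * slack X))
    + t ^+ 2 * (ipTheta (adjoint L X) (adjoint L X) + slack X ^+ 2).
  have resE : residual (Lam + t *: X) = r + t *: adjoint L X.
    by rewrite /r /residual -addrA; congr (g + _);
      rewrite (addrC Lam) adjoint_linear // addrC.
  have slackE : slack (Lam + t *: X) = rho + t * slack X.
    by rewrite /slack mulmxDr -scalemxAr mxtraceD mxtraceZ.
  rewrite /defect resE slackE ip_sqrD -/rho -/r (ipC r (t *: _)) !ipZl.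
  by rewrite (ipC _ (t *: _)) ipZl (ipC _ r); ring.
pose curv X := ipTheta (adjoint L X) (adjoint L X) + slack X ^+ 2.
have first_order X : psdmx X -> 0 <= ipTheta r (adjoint L X) + rho * slack X.
  move=> pX; rewrite -(pmulr_rge0 _ (ltr0Sn R 1)); apply: (slope_ge0 (b := curv X)) => t t0 _.
  rewrite -expand subr_ge0; apply: Lmin; apply: psdmxD => //.
  by apply: psdmxZ => //; exact: ltW.
have complementary : ipTheta r (adjoint L Lam) + rho ^+ 2 <= 0.
  rewrite -oppr_ge0 -(pmulr_rge0 _ (ltr0Sn R 1)); apply: (slope_ge0 (b := curv Lam)) => t t0 t1.
  have := expand Lam (- t); rewrite -/rho sqrrN.
  have := Lmin (Lam + - t *: Lam).
  have -> : Lam + - t *: Lam = (1 - t) *: Lam by rewrite scalerBl scale1r scaleNr.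
  have t1' : 0 <= 1 - t by rewrite subr_ge0.
  move=> /(_ (psdmxZ t1' pL)); rewrite -subr_ge0 => + E; rewrite E /curv -/rho.
  by congr (0 <= _); ring.
have [r0|rn0] := eqVneq (ipTheta r r + rho ^+ 2) 0.
  left; exists Lam; split=> //.
    rewrite -rE; apply: ip_eq0; have := ip_ge0 r; have := sqr_ge0 rho; lra.
  apply/eqP; rewrite -sqrf_eq0 -/(slack Lam) -/rho; apply/eqP.
  have := ip_ge0 r; have := sqr_ge0 rho; lra.
right; exists (-1 *: r), rho; split.
- have -> : ipTheta g (-1 *: r) = - ipTheta r g by rewrite ipC ipZl mulN1r.
  have gE : ipTheta r g = ipTheta r r - ipTheta r (adjoint L Lam).
    by rewrite {3}rE (ipC r (_ + _)) ipDl (ipC r g) (ipC r (adjoint _ _)); ring.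
  have : 0 < ipTheta r r + rho ^+ 2.
    by rewrite lt_def rn0 addr_ge0 ?ip_ge0 ?sqr_ge0.
  lra.
- rewrite /rho /slack -oppr_ge0 -raddfN /= -mulNmx; apply: tr_psdmx_ge0 => //.
  by have /loewner_le0P := symG0; rewrite /loewner_le sub0r => [->].
move=> v; have := first_order (v *m v^T).
have pv : psdmx (v *m v^T) by rewrite -{1}[v]trmxK; exact: psdmx_gram.
move=> /(_ pv); rewrite ipC adjointP // /slack -!qformE.
have -> : L (-1 *: r) = -1 *: L r by exact: (linearZZ (linear_of lL)).
rewrite qformZ; lra.
Qed.

End Multipliers.

(** * Majorization-minimization for quadratic semidefinite programs *)

Section QuadraticProgram.
Context {R : realType} {n N q : nat}.
Notation T := (Theta R n N).
Implicit Types (t s h u : T) (v : 'cV[R]_q).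
Variables (bf : T -> T -> R^o) (bA bB : T -> T -> 'M[R]_q).
Variables (lA : T -> 'M[R]_q) (cA : 'M[R]_q).
Hypothesis bf_bilin : bilin bf.
Hypothesis bA_bilin : bilin bA.
Hypothesis bB_bilin : bilin bB.
Hypothesis lA_linear : linear lA.
Hypothesis bf_pos : forall t, t != 0 -> 0 < bf t t.
Hypothesis bA_sym : forall s t, (bA s t)^T = bA t s.
Hypothesis bB_sym : forall s t, (bB s t)^T = bB t s.
Hypothesis lA_sym : forall t, (lA t)^T = lA t.
Hypothesis cA_sym : cA^T = cA.
Hypothesis bA_psd : forall t v, 0 <= qform (bA t t) v.
Hypothesis bB_psd : forall t v, 0 <= qform (bB t t) v.

Let f t : R := bf t t.
Let A t := bA t t + lA t + cA.
Let B t := bB t t.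
Let dA t h := bA t h + bA h t + lA h.
Let dB t h := bB t h + bB h t.

(** The constraint function linearised at t in its concave part. *)
Let G t s := B s - A t - dA t (s - t).

Hypothesis slater : forall t, exists s delta,
  0 < delta /\ forall v, qform (G t s) v <= - delta * sqlen v.

Local Notation fT := (@findim_Theta R n N).

Lemma diff_f t : 'd f t = (fun h => bf t h + bf h t) :> (T -> R^o).
Proof.
have l0 : linear (fun _ : T => 0 : R^o) by move=> a s u; rewrite scaler0 addr0.
have -> : f = (fun s => bf s s + 0 + 0) by apply/funext => s; rewrite !addr0.
by rewrite (diff_quadratic _ t fT bf_bilin l0); apply/funext => h; rewrite addr0.
Qed.

Lemma diff_A t : 'd A t = dA t :> (T -> 'M[R]_q).
Proof. exact: (diff_quadratic cA t fT bA_bilin lA_linear). Qed.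

Lemma diff_B t : 'd B t = dB t :> (T -> 'M[R]_q).
Proof.
have l0 : linear (fun _ : T => 0 : 'M[R]_q) by move=> a s u; rewrite scaler0 addr0.
have -> : B = (fun s => bB s s + 0 + 0) by apply/funext => s; rewrite !addr0.
by rewrite (diff_quadratic _ t fT bB_bilin l0); apply/funext => h; rewrite addr0.
Qed.

Lemma A_sym t : (A t)^T = A t.
Proof. by rewrite /A !linearD /= bA_sym lA_sym cA_sym. Qed.

Lemma dA_sym t h : (dA t h)^T = dA t h.
Proof. by rewrite /dA !linearD /= !bA_sym lA_sym (addrC (bA h t)). Qed.

Lemma dB_sym t h : (dB t h)^T = dB t h.
Proof. by rewrite /dB linearD /= !bB_sym addrC. Qed.

Lemma G_sym t s : (G t s)^T = G t s.
Proof. by rewrite /G !linearB /= bB_sym A_sym dA_sym. Qed.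

Lemma feasibleE t s : subfeasible A B t s <-> forall v, qform (G t s) v <= 0.
Proof. by rewrite -(loewner_le0P (G_sym t s)) /subfeasible /= diff_A. Qed.

Lemma linear_dA t : linear (dA t).
Proof.
move=> a h k; rewrite /dA (bilinDr bA_bilin) (bilinZr bA_bilin).
rewrite (bilinDl bA_bilin) (bilinZl bA_bilin) lA_linear !scalerDr.
by rewrite [X in X + _ = _]addrACA [LHS]addrACA.
Qed.

Lemma linear_dB t : linear (dB t).
Proof.
move=> a h k; rewrite /dB (bilinDr bB_bilin) (bilinZr bB_bilin).
by rewrite (bilinDl bB_bilin) (bilinZl bB_bilin) !scalerDr addrACA.
Qed.

Let L t h := dB t h - dA t h.

Lemma linear_L t : linear (L t).
Proof.
by move=> a h k; rewrite /L linear_dA linear_dB scalerBr opprD addrACA.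
Qed.

Lemma G_diag t : G t t = B t - A t.
Proof.
have d0 : dA t 0 = 0 by exact: (linear0 (linear_of (linear_dA t))).
by rewrite /G subrr d0 subr0.
Qed.

(** The expansion is exact: L t is the derivative of the constraint B - A at t,
    and the only second-order term of G t is that of B. *)
Lemma qform_G t h v : qform (G t (t + h)) v =
  qform (G t t) v + qform (L t h) v + qform (bB h h) v.
Proof.
have -> : G t (t + h) = B (t + h) - A t - dA t h by rewrite /G (addrAC t) subrr add0r.
rewrite G_diag /L /B /dB (bilinDl bB_bilin) !(bilinDr bB_bilin).
rewrite !(qformB, qformD); ring.
Qed.

(** Replacing A by its linearisation shrinks the feasible set, because A lies
    above its tangents. *)
Lemma qform_G_majorizes t s v : qform (G s s) v <= qform (G t s) v.
Proof.
have [h ->] : exists h, s = t + h by exists (s - t); rewrite addrC subrK.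
have -> : G t (t + h) = B (t + h) - A t - dA t h.
  by rewrite /G (addrAC t) subrr add0r.
have lD : lA (t + h) = lA t + lA h by exact: (linearD (linear_of lA_linear)).
rewrite G_diag /A lD /dA (bilinDl bA_bilin) !(bilinDr bA_bilin).
rewrite !(qformB, qformD); have := bA_psd h v; lra.
Qed.

(** Feasible sets are convex since B lies below its chords. *)
Lemma qform_G_convex t s h (a : R) v : 0 <= a -> a <= 1 ->
  qform (G t (s + a *: h)) v <= (1 - a) * qform (G t s) v + a * qform (G t (s + h)) v.
Proof.
move=> a0 a1; rewrite /G /B !(addrAC s _ (- t)).
have dE k : dA t (s - t + k) = dA t (s - t) + dA t k.
  exact: (linearD (linear_of (linear_dA t))).
have dZ : dA t (a *: h) = a *: dA t h.
  exact: (linearZZ (linear_of (linear_dA t))).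
rewrite !dE dZ !(bilinDl bB_bilin, bilinDr bB_bilin, bilinZl bB_bilin, bilinZr bB_bilin).
have : 0 <= a * (1 - a) * qform (bB h h) v by rewrite !mulr_ge0 ?subr_ge0.
rewrite !(qformB, qformD, qformZ); lra.
Qed.

Lemma continuous_f : continuous f.
Proof.
have ci : continuous (fun t : T => t) by move=> t; exact: cvg_id.
exact: (@bilin_comp_continuous R T T R^o bf T _ _ fT fT bf_bilin ci ci).
Qed.

Lemma continuous_G (X : topologicalType) (t s : X -> T) :
  continuous t -> continuous s -> continuous (fun x => G (t x) (s x)).
Proof.
move=> ct cs; have cst : continuous (fun x => s x - t x).
  by move=> x; exact: (cvgB (cs x) (ct x)).
have cl (u : X -> T) : continuous u -> continuous (fun x : X => lA (u x)).
  exact: linear_comp_continuous fT lA_linear.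
have cB := bilin_comp_continuous fT fT bB_bilin.
have cA' := bilin_comp_continuous fT fT bA_bilin.
move=> x; apply: cvgB; first apply: cvgB.
- exact: (cB _ _ _ cs cs x).
- exact: (cvgD (cvgD (cA' _ _ _ ct ct x) (cl _ ct x)) (cvg_cst _)).
exact: (cvgD (cvgD (cA' _ _ _ ct cst x) (cA' _ _ _ cst ct x)) (cl _ cst x)).
Qed.

Lemma closed_f_le c : closed [set t | f t <= c].
Proof.
apply: (@closed_comp _ _ f [set x | x <= c]); last exact: closed_le.
by move=> t _; apply: continuous_f.
Qed.

Lemma f_lower_bound : exists2 m, 0 < m & forall t, m * `|t| ^+ 2 <= f t.
Proof.
apply: (posdef_lower_bound fT continuous_f) => [a t|t]; last exact: bf_pos.
by rewrite /f (bilinZl bf_bilin) (bilinZr bf_bilin) [LHS]mulrA.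
Qed.

Lemma f_ge0 t : 0 <= f t.
Proof.
have [m m0 mf] := f_lower_bound.
by apply: le_trans (mf t); rewrite mulr_ge0 ?sqr_ge0 // ltW.
Qed.

Lemma sublevel_compact c : compact [set t | f t <= c].
Proof.
have [m m0 mf] := f_lower_bound.
apply: (findim_compact (M := 1 + c / m) fT) => [|t /= tc].
  exact: closed_f_le.
(* the radius comes from |t| <= 1 + |t|^2 *)
have : `|t| ^+ 2 <= c / m by rewrite ler_pdivlMr // mulrC (le_trans (mf t)).
have := sqr_ge0 (`|t| - 1); have := normr_ge0 t; nra.
Qed.

(** The Slater point makes C(t) nonempty, and the sublevel sets of f are
    compact, so the minimum defining the step is attained. *)
Lemma step_argmin t : arg_min_set f (subfeasible A B t) (mm_step f A B t).
Proof.
suff ex : arg_min_set f (subfeasible A B t) !=set0 by exact: (getPex ex).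
have [s0 [delta [delta0 s0P]]] := slater t.
have Cs0 : subfeasible A B t s0.
  apply/feasibleE => v; apply: (le_trans (s0P v)).
  by rewrite mulNr oppr_le0 mulr_ge0 ?sqlen_ge0 // ltW.
pose D := [set s | f s <= f s0] `&` [set s | forall v, qform (G t s) v <= 0].
have cD : compact D.
  apply: compact_closedI; first exact: sublevel_compact.
  apply: closed_qform_le0; apply: continuous_G => x; [exact: cvg_cst|exact: cvg_id].
have D0 : D s0 by split=> /=; [|exact/feasibleE].
have [s] := compact_EVT_min (ex_intro _ _ D0) cD (continuous_subspaceT continuous_f).
rewrite inE => -[fs Gs] smin; exists s; split=> [|s' Cs']; first exact/feasibleE.
have [fs'|/ltW fs'] := leP (f s') (f s0); last exact: le_trans fs fs'.
by apply: smin; rewrite inE; split=> //; exact/feasibleE.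
Qed.

(** Since C(t) is convex, f grows quadratically away from its minimiser. *)
Lemma argmin_descent t s u : arg_min_set f (subfeasible A B t) s ->
  subfeasible A B t u -> f s + f (u - s) <= f u.
Proof.
move=> [/feasibleE Gs smin] /feasibleE Gu; set h := u - s.
have uE : u = s + h by rewrite /h addrC subrK.
have fE (a : R) : f (s + a *: h) = f s + a * (bf s h + bf h s) + a ^+ 2 * f h.
  rewrite /f !(bilinDl bf_bilin, bilinDr bf_bilin, bilinZl bf_bilin, bilinZr bf_bilin).
  by rewrite /GRing.scale /=; ring.
have slope : 0 <= bf s h + bf h s.
  apply: (slope_ge0 (b := f h)) => a a0 a1.
  rewrite -(lerD2l (f s)) addr0 addrA -fE; apply: smin; apply/feasibleE => v.
  apply: (le_trans (qform_G_convex _ _ _ _ (ltW a0) a1)); rewrite -uE.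
  by have := Gs v; have := Gu v; nra.
by rewrite uE -[h in f (s + h)]scale1r fE; lra.
Qed.

(** Along the direction supplied by the alternative, corrected by a small
    multiple of the Slater direction, short steps are strictly feasible and
    decrease f. *)
Lemma no_descent_stationary t :
  (forall v, qform (G t t) v <= 0) ->
  (forall s delta, 0 < delta -> (forall v, qform (G t s) v <= - delta * sqlen v) ->
     f t <= f s) ->
  stationary_point f A B t.
Proof.
move=> Gt nodesc; have symG := G_sym t t.
have [s0 [delta [delta0 s0P]]] := slater t; pose d0 := s0 - t.
have d0P v : qform (G t t) v + qform (L t d0) v <= - delta * sqlen v.
  have := s0P v; rewrite -{1}(subrK t s0) (addrC _ t) qform_G -/d0.
  by have := bB_psd d0 v; lra.
have symL h : (L t h)^T = L t h by rewrite /L linearB /= dB_sym dA_sym.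
have gradE h : ipTheta (gradient f t) h = bf t h + bf h t.
  by rewrite /gradient rieszP diff_f.
have adjE : (fun eta => 'd B t eta - 'd A t eta) = L t.
  apply/funext => h; rewrite /L; congr (_ - _).
    exact: (congr1 (@^~ h) (diff_B t)).
  exact: (congr1 (@^~ h) (diff_A t)).
split; first by rewrite -G_diag; apply/(loewner_le0P symG).
rewrite adjE -G_diag.
have [//|[d [rho [gd rho0 Ld]]]] := multiplier_alternative (gradient f t)
  (linear_L t) symL symG Gt delta0 d0P.
exfalso.
have [e e0 eP] := small_step_neg (ipTheta (gradient f t) d0) gd.
pose d' := d + e *: d0.
have gd' : bf t d' + bf d' t < 0.
  rewrite -gradE ipC ipDl ipZl ![ipTheta _ (gradient _ _)]ipC; exact: eP.
pose k := q%:R * `|bB d' d'|.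
have k0 : 0 <= k by rewrite mulr_ge0.
(* the step a must be small for f to decrease, for the slack to absorb the
   second-order term of B, and for the coefficient of G t t to stay
   nonnegative *)
have [a1 a10 a1P] := small_step_neg (f d') gd'.
have ed0 : - (e * delta) < 0 by rewrite oppr_lt0 mulr_gt0.
have [a2 a20 a2P] := small_step_neg (k + 1) ed0.
have [a3 a30 a3P] := small_step_neg (e - rho) (ltrN10 R).
pose a := Num.min a1 (Num.min a2 a3).
have a0 : 0 < a by rewrite !lt_min a10 a20.
have aP1 := a1P _ a0; rewrite ge_min lexx in aP1; move: (aP1 isT) => {}aP1.
have aP2 := a2P _ a0; rewrite !ge_min lexx !orbT in aP2; move: (aP2 isT) => {}aP2.
have aP3 := a3P _ a0; rewrite !ge_min lexx !orbT in aP3; move: (aP3 isT) => {}aP3.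
have fE : f (t + a *: d') = f t + a * (bf t d' + bf d' t + a * f d').
  rewrite /f !(bilinDl bf_bilin, bilinDr bf_bilin, bilinZl bf_bilin, bilinZr bf_bilin).
  by rewrite /GRing.scale /=; ring.
suff /nodesc : forall v, qform (G t (t + a *: d')) v <= - (a * a) * sqlen v.
  by rewrite mulr_gt0 // fE => /(_ isT); nra.
move=> v; rewrite qform_G.
have -> : L t (a *: d') = a *: (L t d + e *: L t d0).
  have lZ c h : L t (c *: h) = c *: L t h by exact: (linearZZ (linear_of (linear_L t))).
  have lD h h' : L t (h + h') = L t h + L t h' by exact: (linearD (linear_of (linear_L t))).
  by rewrite /d' lZ lD lZ.
rewrite (bilinZl bB_bilin) (bilinZr bB_bilin) !qformZ.
rewrite (qformD (L t d) (e *: L t d0)) qformZ.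
have bk : qform (bB d' d') v <= k * sqlen v by apply: qform_le_norm; rewrite bB_sym.
exact: (strict_step_arith a0 e0 (sqlen_ge0 v) (Gt v) (d0P v) (Ld v) bk aP3 aP2).
Qed.

(** An accumulation point t has the smallest value of f along the iterates, so a
    strictly feasible point of smaller value, being feasible for the iterates
    near t, would contradict the minimality of the next iterate. *)
Theorem mm_iteration_accumulation (theta : nat -> T) :
  (forall k, theta k.+1 = mm_step f A B (theta k)) ->
  converges_to_point_or_continuum theta (stationary_point f A B).
Proof.
move=> stepE.
have argm k : arg_min_set f (subfeasible A B (theta k)) (theta k.+1).
  by rewrite stepE; exact: step_argmin.
have feas k v : qform (G (theta k.+1) (theta k.+1)) v <= 0.
  apply: (le_trans (qform_G_majorizes (theta k) _ _)).
  by have [/feasibleE] := argm k.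
have descent k : f (theta k.+2) + f (theta k.+1 - theta k.+2) <= f (theta k.+1).
  by apply: (argmin_descent (argm k.+1)); apply/feasibleE => v; exact: feas.
have decr k l : (k <= l)%N -> f (theta l.+1) <= f (theta k.+1).
  move=> /subnKC <-; elim: (l - k)%N => [|m IH]; first by rewrite addn0.
  rewrite addnS; apply: le_trans IH; apply: le_trans (descent _).
  by rewrite lerDl f_ge0.
pose K := [set t | f t <= f (theta 1%N)].
have thetaK : \forall k \near \oo, K (theta k).
  by exists 1%N => // -[|k] // _; exact: (@decr 0%N).
have step0 : (fun k => theta k.+1 - theta k) @ \oo --> (0 : T).
  have [m m0 mf] := f_lower_bound.
  exact: descent_steps_vanish m0 mf descent.
suff H t : cluster (theta @ \oo) t -> stationary_point f A B t.
  have cK : compact K by exact: sublevel_compact.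
  exact: (accumulation_dichotomy cK thetaK step0 H).
move=> ct.
apply: no_descent_stationary.
  apply: (cluster_closed (A := [set t | forall v, qform (G t t) v <= 0]) _ _ ct).
    by apply: closed_qform_le0; apply: continuous_G => x; exact: cvg_id.
  by exists 1%N => // -[|k] // _; exact: feas.
move=> s delta delta0 sP; rewrite leNgt; apply/negP => fst.
have ft k : f t <= f (theta k.+1).
  apply: (cluster_closed (A := [set t | f t <= f (theta k.+1)]) _ _ ct).
    exact: closed_f_le.
  by exists k.+1 => // -[|l] // kl; exact: decr.
have near_s : \forall u \near t, forall v, qform (G u s) v <= 0.
  apply: (qform_le0_near _ (fun u => G_sym u s) delta0 sP).
  by apply: continuous_G => x; [exact: cvg_id|exact: cvg_cst].
have /clusterP/(_ _ near_s) := ct; apply; apply: nearW => k Gks.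
have := ft k; rewrite leNgt => /negP; apply; apply: le_lt_trans fst.
by have [_] := argm k; apply; apply/feasibleE.
Qed.

End QuadraticProgram.

(** * Mixed derivatives as limits of second differences *)

Section MixedDifferences.
Context {R : realType} {V : normedModType R}.
Variable phi : V -> R.
Hypothesis phiC2 : twice_cont_diff phi.

Definition second_difference (z a b : V) (s : R) : R :=
  phi (z + s *: a + s *: b) - phi (z + s *: b) - (phi (z + s *: a) - phi z).

Lemma is_derive_line (f : V -> R) (z b : V) (t : R) :
  (forall w, differentiable f w) ->
  is_derive t (1 : R) (fun t : R => f (z + t *: b)) ('D_b f (z + t *: b)).
Proof.
move=> df; have E : (fun h : R => h^-1 *: (f (z + (h *: (1 : R) + t) *: b) - f (z + t *: b))) =
    (fun h => h^-1 *: (f (h *: b + (z + t *: b)) - f (z + t *: b))).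
  apply/funext => h; congr (_ *: (f _ - _)).
  by rewrite scalerDl [h%:A]mulr1 addrCA.
have dv := diff_derivable (v := b) (df (z + t *: b)).
split; first by rewrite /derivable /= E.
by rewrite /derive /= E.
Qed.

Lemma derive_shift (f : V -> R) (c w v : V) :
  'D_v (fun x => f (x + c)) w = 'D_v f (w + c).
Proof.
rewrite /derive /=.
have -> : (fun h : R => h^-1 *: (f (h *: v + w + c) - f (w + c))) =
    (fun h => h^-1 *: (f (h *: v + (w + c)) - f (w + c))).
  by apply/funext => h; rewrite addrA.
by [].
Qed.

Lemma mvt_line (f : V -> R) (z b : V) (s : R) : 0 < s ->
  (forall w, differentiable f w) ->
  exists2 t, (0 < t < s) & f (z + s *: b) - f z = s * 'D_b f (z + t *: b).
Proof.
move=> s0 df; have dl t := is_derive_line z b t df.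
have [] := @MVT R (fun t => f (z + t *: b)) (fun t => 'D_b f (z + t *: b)) 0 s s0.
- by apply: derivable_within_continuous => t _; have [] := dl t.
move=> t; rewrite in_itv /= => ts; rewrite scale0r addr0 subr0 mulrC => E.
by exists t.
Qed.

Lemma second_difference_mvt (z a b : V) (s : R) : 0 < s ->
  exists t u, [/\ 0 < t < s, 0 < u < s &
    second_difference z a b s = s ^+ 2 * 'D_a ('D_b phi) (z + t *: a + u *: b)].
Proof.
move=> s0; have [d1 d2 _] := phiC2.
pose p w := phi (w + s *: a) - phi w.
have dsh w : differentiable (fun w => phi (w + s *: a)) w.
  by apply: differentiable_comp => //; apply: differentiableD.
have dp w : differentiable p w by apply: differentiableB.
have [u us E] := mvt_line z b s0 dp.
have pE : 'D_b p (z + u *: b) = 'D_b phi (z + u *: b + s *: a) - 'D_b phi (z + u *: b).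
  rewrite -(derive_shift phi (s *: a)).
  exact: (deriveB (diff_derivable (dsh _)) (diff_derivable (d1 _))).
have [t ts E'] := mvt_line (z + u *: b) a s0 (d2 b).
exists t, u; split; [exact: ts|exact: us|rewrite (addrAC z (t *: a))].
rewrite pE E' /p (addrAC z (s *: b)) in E.
rewrite /second_difference expr2 -mulrA -E; ring.
Qed.

(** By the mean value theorem in each direction the second difference is s^2
    times the mixed derivative at a point tending to z. *)
Lemma second_difference_cvg (z a b : V) :
  (fun s => second_difference z a b s / s ^+ 2) @ (0 : R)^'+ -->
    'D_a ('D_b phi) z.
Proof.
have [_ _ /(_ b a) cD] := phiC2.
apply/cvgrPdist_lt => e e0.
have /(@cvgrPdist_lt _ R^o)/(_ e e0)/nbhs_ballP[d /= d0 zd] := cD z.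
pose M := `|a| + `|b| + 1.
have M0 : 0 < M by rewrite ltr_wpDl ?addr_ge0.
near=> s.
have s0 : 0 < s by near: s; exact: nbhs_right_gt.
have [t [u [/andP[t0 ts] /andP[u0 us] ->]]] := second_difference_mvt z a b s0.
rewrite mulrAC mulfV ?mul1r ?expf_neq0 ?gt_eqF //; apply: zd.
rewrite -ball_normE /ball_ /= -addrA opprD addrA subrr sub0r normrN.
apply: le_lt_trans (ler_normD _ _) _; rewrite !normrZ !gtr0_norm //.
apply: (@lt_le_trans _ _ (s * M)).
  by rewrite /M; have := normr_ge0 a; have := normr_ge0 b; nra.
rewrite -ler_pdivlMr //; near: s; apply: nbhs_right_le.
by rewrite divr_gt0.
Unshelve. all: by end_near. Qed.

End MixedDifferences.

(** * Gram matrices *)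

Section GramMatrices.
Context {R : realType} {n N : nat}.
Variable x : 'I_N -> 'cV[R]_n.

Lemma gramE (K : 'cV[R]_n -> 'cV[R]_n -> 'M[R]_n) :
  gram K x = \mxblock_(i < N, j < N) K (x i) (x j).
Proof. by rewrite mxblockEv. Qed.

Lemma psdmx_gram_kernel (K : 'cV[R]_n -> 'cV[R]_n -> 'M[R]_n) :
  mxkernel K -> psdmx (gram K x).
Proof. by move=> [_ pK]; rewrite gramE; exact: pK. Qed.

Variable h : 'cV[R]_n -> 'cV[R]_n -> R.
Hypothesis h_kernel : scalar_kernel h.
Hypothesis h_C2 : twice_cont_diff (uncurried h).

(** Points indexed by any finite type, so that shifted and unshifted data points
    can be used together. *)
Lemma scalar_kernel_form_ge0 (I : finType) (z : I -> 'cV[R]_n) (w : I -> R) :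
  0 <= \sum_p \sum_q h (z p) (z q) * (w p * w q).
Proof.
have E (F : I -> R) : \sum_p F p = \sum_(i < #|I|) F (enum_val i).
  by apply: reindex; apply: onW_bij; exact: enum_val_bij.
have [_ /(_ (\col_i w (enum_val i)))] := proj2 h_kernel _ (z \o @enum_val I predT).
rewrite -/(qform _ _) qform_sum E; congr (0 <= _); apply: eq_bigr => i _.
by rewrite E; apply: eq_bigr => j _; rewrite !mxE.
Qed.

Let diff_quotient (y z a b : 'cV[R]_n) (s : R) : R :=
  (h (y + s *: a) (z + s *: b) - h y (z + s *: b)
   - (h (y + s *: a) z - h y z)) / s ^+ 2.

Lemma diff_quotient_cvg y z k l :
  diff_quotient y z (delta_mx k 0) (delta_mx l 0) @ (0 : R)^'+ -->
    mixed_deriv h y z k l.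
Proof.
rewrite mxE.
have -> : diff_quotient y z (delta_mx k 0) (delta_mx l 0) = (fun s =>
    second_difference (uncurried h) (y, z) (delta_mx k 0, 0) (0, delta_mx l 0) s
    / s ^+ 2).
  apply/funext => s; congr (_ / _).
  have pairE (p q : 'cV[R]_n * 'cV[R]_n) (t : R) :
    p + t *: q = (p.1 + t *: q.1, p.2 + t *: q.2) by [].
  by rewrite /second_difference !pairE /uncurried /= !scaler0 !addr0.
exact: second_difference_cvg.
Qed.

(** The difference quotients of a symmetric kernel are symmetric; this is
    Schwarz's theorem for h. *)
Lemma mixed_deriv_tr y z : (mixed_deriv h y z)^T = mixed_deriv h z y.
Proof.
apply/matrixP => k l; rewrite mxE.
have yz : diff_quotient y z (delta_mx l 0) (delta_mx k 0) @ (0 : R)^'+ -->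
  mixed_deriv h y z l k by exact: diff_quotient_cvg.
have zy : diff_quotient z y (delta_mx k 0) (delta_mx l 0) @ (0 : R)^'+ -->
  mixed_deriv h z y k l by exact: diff_quotient_cvg.
suff E : diff_quotient z y (delta_mx k 0) (delta_mx l 0) =
    diff_quotient y z (delta_mx l 0) (delta_mx k 0).
  by rewrite E in zy; exact: (cvg_unique _ yz zy).
apply/funext => s; rewrite /diff_quotient ![h (z + _) _](proj1 h_kernel).
by rewrite ![h z _](proj1 h_kernel); congr (_ / _); ring.
Qed.

(** The quadratic form of the Gram matrix of mixed derivatives is a limit of
    quadratic forms of h itself, at the points x i and x i + s e_k. *)
Lemma psdmx_gram_mixed_deriv : psdmx (gram (mixed_deriv h) x).
Proof.
split.
  by rewrite gramE tr_mxblock; apply: eq_mxblock => i j; rewrite mixed_deriv_tr.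
move=> c; pose C (p : 'I_N * 'I_n) := submxcol c p.1 p.2 0.
pose D (p q : 'I_N * 'I_n) := mixed_deriv h (x p.1) (x q.1) p.2 q.2.
have -> : (c^T *m gram (mixed_deriv h) x *m c) 0 0 =
    \sum_p \sum_q D p q * (C p * C q).
  rewrite -{1 2}[c]submxcolK gramE tr_mxcol mul_mxrow_mxblock mul_mxrow_mxcol summxE.
  rewrite [RHS]exchange_big -(pair_bigA _ (fun j l => \sum_p D p (j, l) * (C p * C (j, l)))) /=.
  apply: eq_bigr => j _; rewrite mxE; apply: eq_bigr => l _.
  rewrite summxE mulr_suml -(pair_bigA _ (fun i k => D (i, k) (j, l) * (C (i, k) * C (j, l)))) /=.
  apply: eq_bigr => i _; rewrite mxE mulr_suml; apply: eq_bigr => k _.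
  rewrite [_^T 0 k]mxE -[D _ _]/(mixed_deriv h (x i) (x j) k l) [RHS]mulrA.
  by rewrite (mulrC (submxcol c i k 0)).
pose Q s p q := diff_quotient (x p.1) (x q.1) (delta_mx p.2 0) (delta_mx q.2 0) s.
have cQ : (fun s => \sum_p \sum_q Q s p q * (C p * C q)) @ (0 : R)^'+ -->
    \sum_p \sum_q D p q * (C p * C q).
  apply: cvg_big => [|p _]; first exact: add_continuous.
  apply: cvg_big => [|q _]; first exact: add_continuous.
  by apply: cvgM; [exact: diff_quotient_cvg|exact: cvg_cst].
rewrite -(cvg_lim (@Rhausdorff R) cQ); apply: limr_ge.
  by apply/cvg_ex; eexists; exact: cQ.
near=> s.
have s0 : 0 < s by near: s; exact: nbhs_right_gt.
pose z (P : 'I_N * 'I_n * bool) :=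
  if P.2 then x P.1.1 + s *: delta_mx P.1.2 0 else x P.1.1.
(* second differences arise by giving the shifted and unshifted points
   opposite coefficients *)
pose w (P : 'I_N * 'I_n * bool) := if P.2 then C P.1 else - C P.1.
have := scalar_kernel_form_ge0 z w.
rewrite -(pair_bigA _ (fun p b => \sum_Q h (z (p, b)) (z Q) * (w (p, b) * w Q))) /=.
have -> : \sum_p \sum_b \sum_Q h (z (p, b)) (z Q) * (w (p, b) * w Q) =
    s ^+ 2 * \sum_p \sum_q Q s p q * (C p * C q).
  rewrite mulr_sumr; apply: eq_bigr => p _.
  rewrite exchange_big -(pair_bigA _ (fun q b =>
    \sum_b1 h (z (p, b1)) (z (q, b)) * (w (p, b1) * w (q, b)))) /=.
  rewrite mulr_sumr; apply: eq_bigr => q _.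
  rewrite !big_bool /z /w /= /Q /diff_quotient; field.
  by rewrite gt_eqF.
by rewrite pmulr_rge0 // exprn_gt0.
Unshelve. all: by end_near. Qed.

End GramMatrices.

(** * The identification program *)

Section BlockDiagonal.
Context {R : realType} {m k q : nat}.
Implicit Types D : 'I_m -> 'M[R]_k.

Definition blockdiag D (E : 'M[R]_q) : 'M[R]_(\sum_(i < m) k + q) :=
  block_mx (\mxdiag_(i < m) D i) 0 0 E.

Lemma eq_blockdiag D D' E E' :
  (forall i, D i = D' i) -> E = E' -> blockdiag D E = blockdiag D' E'.
Proof. by move=> DD ->; rewrite /blockdiag (eq_mxdiag DD). Qed.

Lemma scale_mxdiag a D : a *: \mxdiag_(i < m) D i = \mxdiag_(i < m) (a *: D i).
Proof.
apply/mxblockP => i j; rewrite [in RHS]/mxdiag mxblockK.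
have -> : submxblock (a *: \mxdiag_(i < m) D i) i j = a *: submxblock (\mxdiag_(i < m) D i) i j.
  by apply/matrixP => r s; rewrite !mxE.
rewrite /mxdiag mxblockK; case: eqP => [_|_]; last by rewrite scaler0.
by rewrite !conform_mx_id.
Qed.

Lemma blockdiagD D D' E E' :
  blockdiag D E + blockdiag D' E' = blockdiag (fun i => D i + D' i) (E + E').
Proof. by rewrite /blockdiag add_block_mx !addr0 -mxdiagD. Qed.

Lemma blockdiagZ a D E : a *: blockdiag D E = blockdiag (fun i => a *: D i) (a *: E).
Proof. by rewrite /blockdiag scale_block_mx !scaler0 scale_mxdiag. Qed.

Lemma blockdiagB D D' E E' :
  blockdiag D E - blockdiag D' E' = blockdiag (fun i => D i - D' i) (E - E').
Proof. by rewrite /blockdiag opp_block_mx add_block_mx !oppr0 !addr0 -mxdiagB. Qed.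

Lemma tr_blockdiag D E : (blockdiag D E)^T = blockdiag (fun i => (D i)^T) E^T.
Proof. by rewrite /blockdiag tr_block_mx !trmx0 tr_mxdiag. Qed.

Lemma linear_blockdiag (V : lmodType R) (D : V -> 'I_m -> 'M[R]_k) (E : V -> 'M[R]_q) :
  (forall i, linear (D^~ i)) -> linear E -> linear (fun t => blockdiag (D t) (E t)).
Proof.
move=> lD lE a s t; rewrite blockdiagZ blockdiagD; apply: eq_blockdiag => [i|].
  exact: lD.
exact: lE.
Qed.

Lemma bilin_blockdiag (U V : lmodType R) (D : 'I_m -> U -> V -> 'M[R]_k) :
  (forall i, bilin (D i)) -> bilin (fun s t => blockdiag (fun i => D i s t) 0).
Proof.
move=> bD; have l0 (W : lmodType R) : linear (fun _ : W => 0 : 'M[R]_q).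
  by move=> a s t; rewrite scaler0 addr0.
split=> w; apply: linear_blockdiag => // i; first exact: (proj1 (bD i)).
exact: (proj2 (bD i) w).
Qed.

Lemma psdmx_blockdiag D E :
  (forall i, psdmx (D i)) -> psdmx E -> psdmx (blockdiag D E).
Proof. by move=> pD pE; apply: psdmx_block => //; exact: psdmx_diag. Qed.

End BlockDiagonal.

Lemma block_strict_bound {R : realType} {p q : nat} (U : 'M[R]_p) (v : 'cV[R]_(p + q)) :
  U^T = U ->
  qform (block_mx (U - (p%:R * `|U| + 1)%:M) 0 0 (- 2%:M)) v <= - 1 * sqlen v.
Proof.
move=> sU; rewrite -[v]vsubmxK; move: (usubmx v) (dsubmx v) => v1 v2.
have -> : sqlen (col_mx v1 v2) = sqlen v1 + sqlen v2.
  by rewrite /sqlen tr_col_mx mul_row_col mxtraceD.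
have -> : qform (block_mx (U - (p%:R * `|U| + 1)%:M) 0 0 (- 2%:M)) (col_mx v1 v2) =
    qform (U - (p%:R * `|U| + 1)%:M) v1 + qform (- 2%:M) v2.
  by rewrite /qform tr_col_mx mul_row_block mul_row_col !mulmx0 addr0 add0r mxE.
rewrite qformB qformN !qform_scalar.
by have := qform_le_norm v1 sU; have := sqlen_ge0 v2; lra.
Qed.

Lemma bilin_gram_form {R : realType} (V : lmodType R) (a b : nat) (W : V -> 'M[R]_(a, b)) :
  linear W -> bilin (fun s t => (W s)^T *m W t).
Proof.
move=> lW; split=> w c s t; first by rewrite lW mulmxDr -scalemxAr.
by rewrite lW linearP /= mulmxDl -scalemxAl.
Qed.

Section IdentificationProgram.
Context {R : realType} {n N : nat}.
Variables (f g : 'cV[R]_n -> 'cV[R]_n -> 'M[R]_n).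
Variables (h : 'cV[R]_n -> 'cV[R]_n -> R).
Variables (x xdot : 'I_N -> 'cV[R]_n) (u : 'I_N -> R).
Variables (alpha beta gamma : R).
Notation T := (Theta R n N).
Implicit Types (s t : T) (i : 'I_N).

Let F := gram f x.
Let G := gram g x.
Let H := gram (mixed_deriv h) x.

Definition objective_polar s t : R^o :=
  \tr ((th_p s)^T *m th_p t)
  + alpha * \tr (F *m th_M s *m F *m (th_M t)^T)
  + beta * \tr ((th_c s)^T *m H *m th_c t)
  + gamma * \tr ((th_v s)^T *m G *m th_v t).

Lemma objective_polarE :
  objective f g h x alpha beta gamma = (fun t => objective_polar t t).
Proof. by apply/funext => t; rewrite /objective !mx11_tr. Qed.

Lemma objective_polar_bilin : bilin objective_polar.
Proof.
split=> w a s t; rewrite /objective_polar /th_p /th_M /th_c /th_v /=.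
  rewrite [(a *: _ + _)^T]linearP /= !mulmxDr -!scalemxAr !mxtraceD !mxtraceZ.
  by rewrite /GRing.scale /=; ring.
rewrite ![(a *: _ + _)^T]linearP /= mulmxDr -scalemxAr !mulmxDl -!scalemxAl.
by rewrite !mxtraceD !mxtraceZ /GRing.scale /=; ring.
Qed.

Let X i t := Xblk f x i (th_M t).
Let Y i t := Yblk h x i (th_c t).

Lemma linear_X i : linear (X i).
Proof.
move=> a s t; rewrite /X /Xblk scale_block_mx add_block_mx !scaler0 !addr0.
by congr block_mx; rewrite /th_M /= linearP /= mulmxDr mulmxDl -scalemxAr -scalemxAl.
Qed.

Lemma linear_Y i : linear (Y i).
Proof.
move=> a s t; rewrite /Y /Yblk scale_block_mx add_block_mx !scaler0 !addr0.
by congr block_mx; rewrite /th_c /= mulmxDr -scalemxAr.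
Qed.

(** Polarised second-order part of A: A(t) = Apolar t t + Alin t + Aconst. *)
Definition Apolar s t : 'M[R]_(\sum_(i < N) (n + 1) + \sum_(i < N) n) :=
  blockdiag (fun i => (X i s)^T *m X i t + (Y i s)^T *m Y i t) 0.

Definition Bpolar s t : 'M[R]_(\sum_(i < N) (n + 1) + \sum_(i < N) n) :=
  blockdiag (fun i => (X i s - Y i s)^T *m (X i t - Y i t)) 0.

Let offdiag (r : 'cV[R]_n) : 'M[R]_(n + 1) := block_mx 0 r r^T 0.

Definition Alin t : 'M[R]_(\sum_(i < N) (n + 1) + \sum_(i < N) n) :=
  blockdiag (fun i => offdiag (- u i *: (gram_row g x i *m th_v t))
                      + (th_p t i 0)%:M)
    (th_M t + (th_M t)^T).

Definition Aconst : 'M[R]_(\sum_(i < N) (n + 1) + \sum_(i < N) n) :=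
  blockdiag (fun i => offdiag (xdot i)) 0.

Lemma offdiag_linear : linear offdiag.
Proof.
move=> a r s; rewrite /offdiag scale_block_mx add_block_mx !scaler0 !addr0.
by rewrite linearP.
Qed.

Lemma AmapE : Amap f g h x xdot u = (fun t => Apolar t t + Alin t + Aconst).
Proof.
apply/funext => t; rewrite /Apolar /Alin /Aconst !blockdiagD.
rewrite -[LHS]/(blockdiag _ _); apply: eq_blockdiag; last by rewrite add0r addr0.
move=> i; rewrite /Ablk -/(X i t) -/(Y i t) -!addrA; congr (_ + (_ + _)).
rewrite addrCA addrC; congr (_ + _).
have <- := linearD (linear_of offdiag_linear); congr (offdiag _).
by rewrite /= addrC scaleNr.
Qed.

Lemma BmapE : Bmap f h x = (fun t => Bpolar t t).
Proof. by []. Qed.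

Lemma Apolar_bilin : bilin Apolar.
Proof.
apply: bilin_blockdiag => i; apply: bilin_add.
  exact: (bilin_gram_form (linear_X i)).
exact: (bilin_gram_form (linear_Y i)).
Qed.

Lemma Bpolar_bilin : bilin Bpolar.
Proof.
have lXY i : linear (fun t => X i t - Y i t).
  by move=> a s t; rewrite linear_X linear_Y scalerBr opprD addrACA.
by apply: bilin_blockdiag => i; exact: (bilin_gram_form (lXY i)).
Qed.

Lemma Alin_linear : linear Alin.
Proof.
apply: linear_blockdiag => [i a s t|a s t].
  have -> : - u i *: (gram_row g x i *m th_v (a *: s + t)) =
      a *: (- u i *: (gram_row g x i *m th_v s)) + - u i *: (gram_row g x i *m th_v t).
    by rewrite /th_v /= mulmxDr -scalemxAr scalerDr !scalerA mulrC.
  rewrite offdiag_linear scalerDr addrACA; congr (_ + _).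
  by rewrite /th_p /= !mxE raddfD /= scale_scalar_mx.
by rewrite /th_M /= linearP /= scalerDr addrACA.
Qed.

Lemma Apolar_tr s t : (Apolar s t)^T = Apolar t s.
Proof.
rewrite tr_blockdiag trmx0; apply: eq_blockdiag => // i.
by rewrite linearD /= !trmx_mul !trmxK.
Qed.

Lemma Bpolar_tr s t : (Bpolar s t)^T = Bpolar t s.
Proof.
rewrite tr_blockdiag trmx0; apply: eq_blockdiag => // i.
by rewrite trmx_mul trmxK.
Qed.

Lemma offdiag_tr r : (offdiag r)^T = offdiag r.
Proof. by rewrite /offdiag tr_block_mx trmxK !trmx0. Qed.

Lemma Alin_tr t : (Alin t)^T = Alin t.
Proof.
rewrite tr_blockdiag; apply: eq_blockdiag => [i|].
  by rewrite linearD /= offdiag_tr tr_scalar_mx.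
by rewrite linearD /= trmxK addrC.
Qed.

Lemma Aconst_tr : Aconst^T = Aconst.
Proof. by rewrite tr_blockdiag trmx0; apply: eq_blockdiag => // i; exact: offdiag_tr. Qed.

Lemma Apolar_psd t v : 0 <= qform (Apolar t t) v.
Proof.
apply: (proj2 (psdmx_blockdiag _ (psdmx0 _))) => i.
by apply: psdmxD; exact: psdmx_gram.
Qed.

Lemma Bpolar_psd t v : 0 <= qform (Bpolar t t) v.
Proof. by apply: (proj2 (psdmx_blockdiag _ (psdmx0 _))) => i; exact: psdmx_gram. Qed.

(** With M = I the last block of the constraint is -2I, and increasing p makes
    the remaining blocks as negative as desired. *)
Lemma slater_point t : exists s delta, 0 < delta /\ forall v,
  qform (Bpolar s s - (Apolar t t + Alin t + Aconst)
         - (Apolar t (s - t) + Apolar (s - t) t + Alin (s - t))) v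
    <= - delta * sqlen v.
Proof.
pose S (r : R) : T := (const_mx r, 1%:M, 0, 0).
pose gap s := Bpolar s s - (Apolar t t + Alin t + Aconst)
         - (Apolar t (s - t) + Apolar (s - t) t + Alin (s - t)).
have gap_tr s : (gap s)^T = gap s.
  have := Alin_tr (s - t); have := Apolar_tr (s - t) t; have := Apolar_tr t (s - t).
  have := Aconst_tr; have := Alin_tr t; have := Apolar_tr t t; have := Bpolar_tr s s.
  rewrite /gap; move: (Bpolar s s) (Apolar t t) (Alin t) Aconst (Apolar t (s - t)).
  move: (Apolar (s - t) t) (Alin (s - t)) => b1 b2 b3 b4 b5 b6 b7 e3 e4 e5 e6 e7 e1 e2.
  rewrite !linearB /= !linearD /= e1 e2 e3 e4 e5 e6 e7.
  by rewrite (addrC (- b7)).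
have gapS r : gap (S r) = gap (S 0) - blockdiag (fun=> r%:M) 0.
  have lE : Alin (S r - t) = Alin (S 0 - t) + blockdiag (fun=> r%:M) 0.
    rewrite /Alin blockdiagD; apply: eq_blockdiag => [i|]; last by rewrite addr0.
    rewrite -[RHS]addrA; congr (_ + _).
    rewrite /th_p /= !mxE -raddfD /=; congr (_%:M); ring.
  rewrite /gap -[Bpolar (S r) (S r)]/(Bpolar (S 0) (S 0)).
  rewrite -[Apolar t (S r - t)]/(Apolar t (S 0 - t)).
  rewrite -[Apolar (S r - t) t]/(Apolar (S 0 - t) t) lE.
  have assoc (W : zmodType) (a b c d : W) : a - (b + (c + d)) = a - (b + c) - d.
    by rewrite addrA opprD addrA.
  exact: assoc.
have [U gap0] : exists U, gap (S 0) = block_mx U 0 0 (- 2%:M).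
  have comb (D1 D2 D3 D4 D5 D6 D7 : 'I_N -> 'M[R]_(n + 1))
      (E1 E2 E3 E4 E5 E6 E7 : 'M[R]_(\sum_(i < N) n)) :
      blockdiag D1 E1 - (blockdiag D2 E2 + blockdiag D3 E3 + blockdiag D4 E4)
        - (blockdiag D5 E5 + blockdiag D6 E6 + blockdiag D7 E7) =
      blockdiag (fun i => D1 i - (D2 i + D3 i + D4 i) - (D5 i + D6 i + D7 i))
        (E1 - (E2 + E3 + E4) - (E5 + E6 + E7)).
    by rewrite !(blockdiagD, blockdiagB).
  rewrite /gap /Bpolar /Apolar /Alin /Aconst comb; eexists; rewrite /blockdiag; congr block_mx.
  rewrite /th_M /= linearB /= trmx1 !addr0 !add0r.
  move: t.1.1.2 => M; rewrite -opprD; congr (- _).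
  by rewrite addrACA subrKC subrKC -raddfD.
have sU : U^T = U.
  by have := gap_tr (S 0); rewrite gap0 tr_block_mx => /eq_block_mx[].
exists (S ((\sum_(i < N) (n + 1))%:R * `|U| + 1)), 1; split=> // v.
rewrite -/(gap _) gapS gap0 /blockdiag mxdiagZ opp_block_mx add_block_mx !oppr0 !addr0.
exact: block_strict_bound.
Qed.

Hypothesis alpha_gt0 : 0 < alpha.
Hypothesis beta_gt0 : 0 < beta.
Hypothesis gamma_gt0 : 0 < gamma.
Hypothesis pF : psdmx F.
Hypothesis pG : psdmx G.
Hypothesis pH : psdmx H.
Hypothesis uF : F \in unitmx.
Hypothesis uG : G \in unitmx.
Hypothesis uH : H \in unitmx.

Lemma objective_polar_gt0 t : t != 0 -> 0 < objective_polar t t.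
Proof.
rewrite /objective_polar -!mx11_tr -/(qform H _) -/(qform G _).
move=> t0.
have pp : 0 <= ((th_p t)^T *m th_p t) 0 0 by rewrite mx11_tr sqnorm_ge0.
have MM : 0 <= alpha * \tr (F *m th_M t *m F *m (th_M t)^T).
  have [->|/(psdmx_unit_conj_gt0 pF uF) M0] := eqVneq (th_M t) 0.
    by rewrite trmx0 mulmx0 mxtrace0 mulr0.
  by rewrite mulr_ge0 // ltW.
have cc : 0 <= beta * qform H (th_c t)
  by apply: mulr_ge0; [exact: ltW|exact: (proj2 pH)].
have vv : 0 <= gamma * qform G (th_v t)
  by apply: mulr_ge0; [exact: ltW|exact: (proj2 pG)].
have [p0|p0] := eqVneq (th_p t) 0; last first.
  have : 0 < ((th_p t)^T *m th_p t) 0 0.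
    by rewrite lt_def pp andbT; apply: contra p0; rewrite mx11_tr => /eqP/sqnorm_eq0->.
  lra.
have [M0|/(psdmx_unit_conj_gt0 pF uF)] := eqVneq (th_M t) 0; last first.
  by rewrite -(pmulr_rgt0 _ alpha_gt0); lra.
have [c0|/(psdmx_unit_qform_gt0 pH uH)] := eqVneq (th_c t) 0; last first.
  by rewrite -(pmulr_rgt0 _ beta_gt0); lra.
have [v0|/(psdmx_unit_qform_gt0 pG uG)] := eqVneq (th_v t) 0; last first.
  by rewrite -(pmulr_rgt0 _ gamma_gt0); lra.
exfalso; move/eqP: t0; apply; move: p0 M0 c0 v0.
by case: t {pp MM cc vv} => [[[p M] c] v]; rewrite /th_p /th_M /th_c /th_v /= => -> -> -> ->.
Qed.

End IdentificationProgram.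

Theorem theorem7 (R : realType) (n N : nat)
  (x xdot : 'I_N -> 'cV[R]_n) (u : 'I_N -> R)
  (alpha beta gamma : R)
  (alpha_gt0 : 0 < alpha) (beta_gt0 : 0 < beta) (gamma_gt0 : 0 < gamma)
  (f g : 'cV[R]_n -> 'cV[R]_n -> 'M[R]_n) (h : 'cV[R]_n -> 'cV[R]_n -> R)
  (f_kernel : mxkernel f) (g_kernel : mxkernel g) (h_kernel : scalar_kernel h)
  (h_C2 : twice_cont_diff (uncurried h))
  (F_inv : gram f x \in unitmx)
  (H_inv : gram (mixed_deriv h) x \in unitmx)
  (G_inv : gram g x \in unitmx)
  (theta : nat -> Theta R n N)
  (theta0_feasible : strictly_feasible f g h x xdot u (theta 0%N))
  (theta_step : forall k, theta k.+1 =
     mm_step (objective f g h x alpha beta gamma)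
       (Amap f g h x xdot u) (Bmap f h x) (theta k)) :
  converges_to_point_or_continuum theta
    (stationary_point (objective f g h x alpha beta gamma)
       (Amap f g h x xdot u) (Bmap f h x)).
Proof.
rewrite objective_polarE AmapE BmapE in theta_step *.
apply: mm_iteration_accumulation theta_step.
- exact: objective_polar_bilin.
- exact: Apolar_bilin.
- exact: Bpolar_bilin.
- exact: Alin_linear.
- apply: objective_polar_gt0 => //.
  + exact: psdmx_gram_kernel.
  + exact: psdmx_gram_kernel.
  + exact: psdmx_gram_mixed_deriv.
- exact: Apolar_tr.
- exact: Bpolar_tr.
- exact: Alin_tr.
- exact: Aconst_tr.
- exact: Apolar_psd.
- exact: Bpolar_psd.
exact: slater_point.
Qed.
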